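(* Let $d=2^n$, let $\rho$ be any density operator on $\mathbb{C}^d$ and $H$ any Hermitian operator on $\mathbb{C}^d$. For a unitary $U\in U(d)$ consider the probe state $\sigma=U\rho U^\dagger$ and the family $\sigma_\theta=e^{-i\theta H}\sigma e^{i\theta H}$. Then the sub-QFI $\mathcal{I}(U\rho U^\dagger)$ and the QFI $I(U\rho U^\dagger)$, viewed as functions of $U\in U(d)$, are maximized by the same state preparation: there is a unitary $$U_*=\operatorname{argmax}_{U\in U(d)}\mathcal{I}(U\rho U^\dagger)=\operatorname{argmax}_{U\in U(d)} I(U\rho U^\dagger),$$ i.e. $U_*\rho U_*^\dagger$ maximizes both quantities simultaneously.
   Context: For density operators $\rho,\sigma$: Uhlmann fidelity $F(\rho,\sigma)=\|\sqrt{\rho}\sqrt{\sigma}\|_1$ (trace norm), and super-fidelity $G(\rho,\sigma)=\mathrm{Tr}[\rho\sigma]+\sqrt{(1-\mathrm{Tr}[\rho^2])(1-\mathrm{Tr}[\sigma^2])}$. For a probe state $\sigma$ with $\sigma_\theta=e^{-i\theta H}\sigma e^{i\theta H}$, the QFI is $I(\sigma)=8\lim_{\delta\to0}\frac{1-F(\sigma_\theta,\sigma_{\theta+\delta})}{\delta^2}$ and the sub-QFI is $\mathcal{I}(\sigma)=8\lim_{\delta\to0}\frac{1-\sqrt{G(\sigma_\theta,\sigma_{\theta+\delta})}}{\delta^2}$ (both are independent of $\theta$). *)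

(* Defs.v *)
From HB Require Import structures.
From mathcomp Require Import all_boot all_order all_algebra.
From mathcomp Require Import all_classical all_reals all_analysis.
From mathcomp Require Import complex.
Import Order.TTheory GRing.Theory Num.Theory.
Import numFieldNormedType.Exports.
Set Implicit Arguments. Unset Strict Implicit. Unset Printing Implicit Defensive.
Local Open Scope classical_set_scope.
Local Open Scope ring_scope.

Section QInfo.
Variable R : realType.
Local Notation C := R[i].
Variable d : nat.
Local Notation mat := 'M[C]_d.

Definition dagger (A : mat) : mat := (map_mx Num.conj A)^T.

Definition hermitian_mx (A : mat) : Prop := dagger A = A.

Definition psd_mx (A : mat) : Prop :=
  hermitian_mx A /\ forall v : 'cV[C]_d, 0 <= ((map_mx Num.conj v)^T *m A *m v) 0 0.

Definition density_mx (A : mat) : Prop := psd_mx A /\ \tr A = 1.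

Definition unitary_mx (U : mat) : Prop := dagger U *m U = 1%:M.

(* the (unique) positive semidefinite square root of a psd_mx matrix *)
Definition msqrt (A : mat) : mat := xget 0 [set B | psd_mx B /\ B *m B = A].

Definition trnorm (A : mat) : R := complex.Re (\tr (msqrt (dagger A *m A))).

Definition fidelity (rho sigma : mat) : R := trnorm (msqrt rho *m msqrt sigma).

Definition superfidelity (rho sigma : mat) : R :=
  complex.Re (\tr (rho *m sigma))
  + Num.sqrt ((1 - complex.Re (\tr (rho *m rho))) * (1 - complex.Re (\tr (sigma *m sigma)))).

Definition mexp (A : mat) : mat :=
  limn (series (fun k : nat => (k`!%:R)^-1 *: A ^+ k)).

Definition evolve (H : mat) (theta : R) (sigma : mat) : mat :=
  mexp (- ((theta%:C)%C * 'i%C) *: H) *m sigma *m mexp (((theta%:C)%C * 'i%C) *: H).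

Definition QFI (H : mat) (theta : R) (sigma : mat) : R :=
  8 * lim ((fun delta : R =>
     (1 - fidelity (evolve H theta sigma) (evolve H (theta + delta) sigma)) / delta ^+ 2)
     @ 0^').

Definition subQFI (H : mat) (theta : R) (sigma : mat) : R :=
  8 * lim ((fun delta : R =>
     (1 - Num.sqrt (superfidelity (evolve H theta sigma) (evolve H (theta + delta) sigma)))
       / delta ^+ 2) @ 0^').

End QInfo.

(* Main.v *)
(* Write sigma = V diag(p) V^* and K = V^* H V.  The sub-QFI is
   2 sum_ij (p_i - p_j)^2 |K_ij|^2 and the QFI is
   2 sum_ij (p_i - p_j)^2 / (p_i + p_j) |K_ij|^2.  For the QFI the fidelity is
   bounded below by Re tr(sqrt(sigma) V_x sqrt(sigma) W) for a well-chosen unitary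
   W, and above by Alberti's variational formula, with a test operator built from
   the symmetric logarithmic derivative; the two bounds agree to second order.

   When p is sorted, both weights w(p_i, p_j), i < j, are nonnegative combinations
   of indicators of corner blocks {i < a, j >= b}, a <= b.  Von Neumann's trace
   inequality shows that such an off-diagonal block of K has squared
   Hilbert-Schmidt norm at most
   1/4 sum_(k < min(a, d - b)) (h_k - h_(d-1-k))^2, where h is the sorted spectrum
   of H.  Pairing the eigenvectors of H for h_k and h_(d-1-k) attains all these
   bounds at once, whence a preparation that is optimal for both weights. *)
Require Import Defs.
From HB Require Import structures.
From mathcomp Require Import all_boot all_order all_algebra.
From mathcomp Require Import all_classical all_reals all_analysis.
From mathcomp Require Import perm.
From mathcomp Require Import complex ring lra zify.
Import Order.TTheory GRing.Theory Num.Theory.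
Import numFieldNormedType.Exports.
Set Implicit Arguments. Unset Strict Implicit. Unset Printing Implicit Defensive.
Local Open Scope ring_scope.

(** * Rearrangement and corner-block weights *)

(** The fidelity is never differentiated, because matrix square roots are not smooth where the
    spectrum of the state touches zero. Instead 1 - F is squeezed between two explicit functions,
    each built from the best first-order choice: in one, the Hermitian K' generating W minimizes the
    Hilbert-Schmidt norm of K sqrt(sigma) - sqrt(sigma) K'; in the other, the test operator is 1 + x
    L. These choices make both sides agree at order x^2, zero eigenvalues included.

    A common maximizer exists because the two weights differ only in the nonnegative coefficients of
    their corner blocks, while the bound on each block depends on the spectrum of H alone. A block
    {i < a, j >= b} meets the antidiagonal j = d-1-k, i = k exactly for k < min(a, d-b), so a K
    whose off-diagonal part is antidiagonal, with moduli |h_k - h_(d-1-k)|/2, saturates every block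
    whatever the coefficients. The value |h_k - h_(d-1-k)|/2 is the off-diagonal entry of diag(h_k,
    h_(d-1-k)) rotated by 45 degrees, whence the 1/4. *)

Section Rearrangement.
Variable R : realFieldType.

Definition nonincr n (h : 'I_n -> R) := forall i j : 'I_n, (i <= j)%N -> h j <= h i.

(** Abel summation. Keeping the total of [g], weighted by the last coefficient [h n], lets the
    induction close; in [abel_ge0] this total is zero. *)
Lemma abel_ge n (h g : nat -> R) :
  (forall i j, (i <= j < n.+1)%N -> h j <= h i) ->
  (forall k, (k <= n)%N -> 0 <= \sum_(i < k) g i) ->
  h n * \sum_(i < n.+1) g i <= \sum_(i < n.+1) h i * g i.
Proof.
elim: n => [|n ih] hh hg; first by rewrite !big_ord1.
rewrite big_ord_recr /= [leRHS]big_ord_recr /= mulrDr lerD2r.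
apply: le_trans (ih _ _).
- by apply: ler_wpM2r; [exact: hg|apply: hh; rewrite leqnSn ltnSn].
- by move=> i j /andP[ij jn]; apply: hh; rewrite ij ltnW.
- by move=> k kn; apply: hg; exact: leqW.
Qed.

Lemma abel_ge0 n (h g : 'I_n -> R) : nonincr h -> \sum_i g i = 0 ->
  (forall k, (k <= n)%N -> 0 <= \sum_(i < n | (i < k)%N) g i) ->
  0 <= \sum_i h i * g i.
Proof.
case: n h g => [|n] h g hh g0 hg; first by rewrite big_ord0.
have E (F : 'I_n.+1 -> R) k : (k <= n.+1)%N ->
    \sum_(i < n.+1 | (i < k)%N) F i = \sum_(i < k) F (inord i).
  move=> kn; rewrite (big_ord_widen _ (fun i => F (inord i)) kn).
  by apply: eq_bigr => i _; rewrite inord_val.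
have /= := @abel_ge n (fun i => h (inord i)) (fun i => g (inord i)).
have E' (F : 'I_n.+1 -> R) : \sum_(i < n.+1) F (inord i) = \sum_i F i.
  by apply: eq_bigr => i _; rewrite inord_val.
rewrite (E' (fun i => h i * g i)) (E' g) g0 mulr0; apply.
- move=> i j /andP[ij jn]; apply: hh; rewrite !inordK//; exact: leq_ltn_trans jn.
- by move=> k kn; rewrite -E ?leqW//; exact: hg (leqW kn).
Qed.

(** By Abel summation only sums over leading indices have to be compared, and doubly stochastic
    averaging of a sorted [x] cannot increase these. *)
Lemma rearrangement n (h x : 'I_n -> R) (D : 'I_n -> 'I_n -> R) :
  nonincr h -> nonincr x -> (forall a b, 0 <= D a b) ->
  (forall a, \sum_b D a b = 1) -> (forall b, \sum_a D a b = 1) ->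
  \sum_a \sum_b h a * x b * D a b <= \sum_a h a * x a.
Proof.
move=> hh hx D0 D1 D1'; rewrite -subr_ge0 -sumrB.
under eq_bigr => a _.
  under eq_bigr do rewrite -mulrA.
  rewrite -mulr_sumr -mulrBr; over.
apply: abel_ge0 => // [|k kn].
  rewrite sumrB exchange_big /= -sumrB big1// => b _.
  by rewrite -mulr_sumr D1' mulr1 subrr.
case: k kn => [|k] kn; first by rewrite big_pred0.
rewrite sumrB exchange_big /= (big_mkcond (fun i : 'I_n => (i < k.+1)%N)) /= -sumrB.
pose c b := \sum_(a < n | (a < k.+1)%N) D a b.
have cE b : \sum_(a < n | (a < k.+1)%N) x b * D a b = x b * c b by rewrite -mulr_sumr.
under eq_bigr do rewrite cE.
have c0 b : 0 <= c b by apply: sumr_ge0.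
have c1 b : c b <= 1.
  by rewrite -(D1' b) [leRHS](bigID (fun a : 'I_n => (a < k.+1)%N)) /= lerDl sumr_ge0.
have csum : \sum_b c b = \sum_(b < n) (b < k.+1)%N%:R.
  rewrite exchange_big /= [LHS]big_mkcond /=; apply: eq_bigr => b _.
  by case: ifP => //; rewrite D1.
(* [t] is the least of the first [k.+1] values of [x]. Subtracting it changes nothing, since by
   [csum] the coefficients sum to zero, and it leaves products of two factors of the same sign. *)
pose t := x (Ordinal kn).
have -> : \sum_(b < n) ((if (b < k.+1)%N then x b else 0) - x b * c b) =
   \sum_(b < n) ((b < k.+1)%N%:R - c b) * (x b - t).
  transitivity (\sum_(b < n) ((b < k.+1)%N%:R - c b) * x b); last first.
    under [RHS]eq_bigr do rewrite mulrBr.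
    by rewrite sumrB -[X in _ - X]mulr_suml sumrB csum subrr mul0r subr0.
  by apply: eq_bigr => b _; case: ifP; rewrite ?mulrBl ?mul1r ?mul0r mulrC.
apply: sumr_ge0 => b _; case: (ltnP b k.+1) => bk.
  by rewrite mulr_ge0// subr_ge0// hx.
by rewrite mulr_le0// ?sub0r ?oppr_le0// subr_le0 hx// ltnW.
Qed.

Lemma rearrangement_rev n (h x : 'I_n -> R) (D : 'I_n -> 'I_n -> R) :
  nonincr h -> nonincr x -> (forall a b, 0 <= D a b) ->
  (forall a, \sum_b D a b = 1) -> (forall b, \sum_a D a b = 1) ->
  \sum_a h (rev_ord a) * x a <= \sum_a \sum_b h a * x b * D a b.
Proof.
move=> hh hx D0 D1 D1'.
have hh' : nonincr (fun a => - h (rev_ord a)).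
  by move=> i j ij; rewrite lerN2; apply: hh; rewrite leq_sub2l.
have Dr b : \sum_a D (rev_ord a) b = 1.
  by rewrite -(D1' b) [RHS](reindex_inj rev_ord_inj).
have := rearrangement hh' hx (fun a => D0 (rev_ord a)) (fun a => D1 (rev_ord a)) Dr.
under eq_bigr do under eq_bigr do rewrite !mulNr.
under eq_bigr do rewrite sumrN.
under [X in _ <= X -> _]eq_bigr do rewrite mulNr.
rewrite !sumrN lerN2 => H; apply: (le_trans H).
by rewrite [leRHS](reindex_inj rev_ord_inj).
Qed.

Definition gap n (h : 'I_n -> R) k := h k - h (rev_ord k).

Lemma gap_rev n (h : 'I_n -> R) k : gap h (rev_ord k) = - gap h k.
Proof. by rewrite /gap rev_ordK opprB. Qed.

(* [gap h] is largest in absolute value on the outermost indices. *)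
Lemma sum_gap_le n (h : 'I_n -> R) (A : pred 'I_n) m : nonincr h ->
  (m + m <= n)%N -> (#|A| <= m + m)%N ->
  \sum_(k | A k) gap h k ^+ 2 <= 2 * \sum_(k < n | (k < m)%N) gap h k ^+ 2.
Proof.
move=> hh mn Am.
(* Indicator of the m first and m last indices, which are disjoint because m + m <= n. *)
pose t (k : 'I_n) : R := (k < m)%N%:R + (rev_ord k < m)%N%:R.
have tsum (f : 'I_n -> R) : (forall k, f (rev_ord k) = f k) ->
    \sum_k t k * f k = 2 * \sum_(k < n | (k < m)%N) f k.
  move=> fr; under eq_bigr do rewrite mulrDl.
  rewrite big_split /= [X in _ + X](reindex_inj rev_ord_inj) /=.
  under [X in _ + X]eq_bigr do rewrite fr -[(n - _)%N]/(nat_of_ord (rev_ord (rev_ord _))) rev_ordK.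
  rewrite -mulr2n [in RHS]big_mkcond /= mulr_natl; congr (_ *+ _).
  by apply: eq_bigr => k _; case: ifP; rewrite ?mul1r ?mul0r.
rewrite -tsum => [|k]; last by rewrite gap_rev sqrrN.
case: m => [|m] in mn Am t tsum *.
  have A0 : A =1 pred0 by apply: fintype.card0_eq; apply/eqP; rewrite -leqn0.
  rewrite big_pred0 //; apply: sumr_ge0 => k _.
  by rewrite mulr_ge0 ?sqr_ge0// addr_ge0.
have mn1 : (m < n)%N by apply: leq_trans mn; rewrite leq_addr.
(* [c] is the smallest squared gap among the outermost indices. Comparing with this threshold index
   by index gives [tc]; the cardinality bound on [A] then absorbs the multiples of [c]. *)
pose o := Ordinal mn1; pose c := gap h o ^+ 2.
have gap0 (k : 'I_n) : (k <= rev_ord k)%N -> 0 <= gap h k by move=> kk; rewrite subr_ge0 hh.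
have om : (o <= rev_ord o)%N by rewrite /=; lia.
have tc (k : 'I_n) : t k * (gap h k ^+ 2 - c) >= (A k)%:R * (gap h k ^+ 2 - c).
  have hi (j : 'I_n) : (j < m.+1)%N -> c <= gap h j ^+ 2.
    move=> jm; rewrite /c ler_sqr ?nnegrE ?gap0//; last by rewrite /=; lia.
    by rewrite /gap lerB// hh//=; lia.
  rewrite /t; have [km|km] := ltnP k m.+1.
    have -> : (rev_ord k < m.+1)%N = false by apply/negbTE; rewrite /= -leqNgt; lia.
    rewrite addr0 mul1r; case: (A k); rewrite ?mul1r// mul0r subr_ge0; exact: hi.
  rewrite add0r; have [rm|rm] := ltnP (rev_ord k) m.+1.
    rewrite mul1r; case: (A k); rewrite ?mul1r// mul0r subr_ge0.
    by rewrite -sqrrN -gap_rev; exact: hi.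
  rewrite mul0r; case: (A k); rewrite ?mul0r// mul1r subr_le0 /c.
  rewrite -[leLHS]real_normK ?num_real// ler_sqr ?nnegrE ?gap0// ler_norml /gap.
  move: km rm => /= km rm.
  have h1 : h k <= h o by apply: hh => /=; lia.
  have h2 : h (rev_ord k) <= h o by apply: hh => /=; lia.
  have h3 : h (rev_ord o) <= h k by apply: hh => /=; lia.
  have h4 : h (rev_ord o) <= h (rev_ord k) by apply: hh => /=; lia.
  by apply/andP; split; lra.
have : \sum_k (A k)%:R * (gap h k ^+ 2 - c) <= \sum_k t k * (gap h k ^+ 2 - c).
  by apply: ler_sum => k _; exact: tc.
under eq_bigr do rewrite mulrBr.
under [X in _ <= X -> _]eq_bigr do rewrite mulrBr.
rewrite !sumrB.
have -> : \sum_k (A k)%:R * gap h k ^+ 2 = \sum_(k | A k) gap h k ^+ 2.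
  by rewrite [RHS]big_mkcond /=; apply: eq_bigr => k _; case: (A k); rewrite ?mul1r ?mul0r.
have -> : \sum_k (A k)%:R * c = (#|A|)%:R * c.
  rewrite -mulr_suml; congr (_ * _); rewrite -sum1_card natr_sum [RHS]big_mkcond /=.
  by apply: eq_bigr => k _; rewrite unfold_in; case: (A k).
have -> : \sum_k t k * c = (m.+1 + m.+1)%:R * c.
  rewrite (tsum (fun=> c))// -(big_ord_widen n (fun=> c) mn1) sumr_const card_ord natrD.
  by rewrite -mulr_natl; ring.
have c0 : 0 <= c by apply: sqr_ge0.
have : (#|A|)%:R * c <= (m.+1 + m.+1)%:R * c by rewrite ler_wpM2r// ler_nat.
lra.
Qed.

End Rearrangement.

(** * Decomposition of sorted weights into corner blocks *)

Section Weights.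
Variable R : realFieldType.

(* Nonnegative, and with nonnegative mixed differences on [x' <= x], [y' <= y]:
   on the ordered eigenvalues such a weight is a nonnegative combination of
   indicators of corner blocks. *)
Record block_weight (f : R -> R -> R) := BlockWeight {
  weightC : forall x y, f x y = f y x;
  weightxx : forall x, f x x = 0;
  weight_ge0 : forall x y, 0 <= x -> 0 <= y -> 0 <= f x y;
  weight_mixed : forall x x' y y', 0 <= x' <= x -> 0 <= y' <= y ->
    f x y + f x' y' <= f x y' + f x' y }.

Lemma sqr_block_weight : block_weight (fun x y => (x - y) ^+ 2).
Proof.
split => [x y|x|x y _ _|x x' y y' /andP[_ xx] /andP[_ yy]].
- by rewrite -sqrrN opprB.
- by rewrite subrr expr0n.
- exact: sqr_ge0.
- have : 0 <= (x - x') * (y - y') by rewrite mulr_ge0 ?subr_ge0.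
  by move: (x) (x') (y) (y') => a b c e; nra.
Qed.

Lemma divDr_le (x y y' : R) : 0 <= x -> 0 <= y' <= y -> y' / (x + y') <= y / (x + y).
Proof.
move=> x0 /andP[]; rewrite le0r => /predU1P[->|y'0] yy.
  by rewrite mul0r divr_ge0// addr_ge0.
have y0 : 0 < y by exact: lt_le_trans yy.
rewrite ler_pdivrMr ?ltr_wpDl// mulrAC ler_pdivlMr ?ltr_wpDl//.
by rewrite !mulrDr (mulrC y' y) lerD2r [leRHS]mulrC [leLHS]mulrC ler_wpM2l.
Qed.

(** Division by zero gives 0, so a pair of null eigenvalues carries no weight, as in the usual
    formula for the QFI. *)
Definition bures_weight (x y : R) : R := (x - y) ^+ 2 / (x + y).

Lemma bures_block_weight : block_weight bures_weight.
Proof.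
have fE (x y : R) : 0 <= x -> 0 <= y -> bures_weight x y = x + y - 4 * (x * y / (x + y)).
  move=> x0 y0; rewrite /bures_weight; have [xy|xy] := eqVneq (x + y) 0; last by field.
  by rewrite xy invr0 !mulr0 subr0.
split => [x y|x|x y x0 y0|x x' y y' /andP[x'0 xx] /andP[y'0 yy]].
- by rewrite /bures_weight (addrC y x) -(sqrrN (y - x)) opprB.
- by rewrite /bures_weight subrr expr0n mul0r.
- by rewrite divr_ge0 ?sqr_ge0 ?addr_ge0.
- have x0 := le_trans x'0 xx; have y0 := le_trans y'0 yy.
  rewrite !fE//.
  (* The difference factors into a nonnegative constant and two functions nondecreasing in z, which
     gives the mixed-difference inequality for the harmonic mean. *)
  have gE z : 0 <= z -> x * z / (x + z) - x' * z / (x' + z) =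
      (x - x') * ((z / (x + z)) * (z / (x' + z))).
    rewrite le0r => /predU1P[->|z0]; first by rewrite !(mulr0, mul0r) subrr.
    by field; rewrite !gt_eqF// ltr_wpDl.
  have : x * y' / (x + y') - x' * y' / (x' + y') <= x * y / (x + y) - x' * y / (x' + y).
    rewrite !gE//; apply: ler_wpM2l; first by rewrite subr_ge0.
    by apply: ler_pM; rewrite ?divr_ge0 ?addr_ge0// divDr_le// y'0.
  lra.
Qed.

Variables (n : nat) (f : R -> R -> R) (p : 'I_n -> R).
Hypotheses (fW : block_weight f) (p_ge0 : forall i, 0 <= p i) (hp : nonincr p).

(** Indexed by [nat] and zero outside the strict upper triangle, so that finite differences can be
    taken across the border of the index range. *)
Definition upper_weight (i j : nat) : R :=
  match insub i, insub j with
  | Some i', Some j' => if (i < j)%N then f (p i') (p j') else 0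
  | _, _ => 0
  end.
Local Notation W := upper_weight.

Lemma upper_weightE (i j : 'I_n) : W i j = if (i < j)%N then f (p i) (p j) else 0.
Proof. by rewrite /W !valK. Qed.

Lemma upper_weight0 i j : (j <= i)%N -> W i j = 0.
Proof.
by move=> ji; rewrite /W; case: insub => // i'; case: insub => // j'; rewrite ltnNge ji.
Qed.

Lemma upper_weight_out i j : (n <= i)%N -> W i j = 0.
Proof. by move=> ni; rewrite /W insubN// -leqNgt. Qed.

(** Mixed second difference of [W]: the coefficient of the indicator of the corner block {i <= a, j
    > b}. *)
Let c a b := (W a b.+1 - W a.+1 b.+1) - (W a b - W a.+1 b).

Lemma upper_weight_sum (i j : 'I_n) :
  W i j = \sum_(a < n) \sum_(b < n) c a b * ((i <= a)%N && (b < j)%N)%:R.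
Proof.
transitivity (\sum_(i <= a < n) (W a j - W a.+1 j)).
  under eq_bigr do rewrite -opprB; rewrite sumrN telescope_sumr; last exact: ltnW.
  by rewrite (upper_weight_out j (leqnn n)) sub0r opprK.
rewrite big_geq_mkord big_mkcond /=; apply: eq_bigr => a _.
case: leqP => ia; last by rewrite big1// => b _; rewrite mulr0.
transitivity (\sum_(0 <= b < j) c a b).
  by rewrite /c telescope_sumr// !(upper_weight0 (leq0n _)) subrr subr0.
rewrite big_mkord (big_ord_widen n (c a) (ltnW (ltn_ord j))) big_mkcond /=.
by apply: eq_bigr => b _; case: ifP; rewrite ?mulr1 ?mulr0.
Qed.

(** For a = b a single nonnegative entry survives. For a < b all four entries are values of [f],
    including the zero at a.+1 = b because [f] vanishes on equal arguments, and [weight_mixed]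
    applies. *)
Lemma weight_diff_ge0 (a b : nat) : (a <= b)%N -> (b.+1 < n)%N -> 0 <= c a b.
Proof.
move=> ab bn; have bn' : (b < n)%N by exact: ltnW.
have an : (a < n)%N by exact: leq_ltn_trans bn'.
move: ab; rewrite leq_eqVlt => /predU1P[ab|ab].
  rewrite -ab /c !(upper_weight0 (leqnn _)) (upper_weight0 (leqnSn _)) subrr !subr0.
  have bn2 : (a.+1 < n)%N by rewrite ab.
  by rewrite (upper_weightE (Ordinal an) (Ordinal bn2)) /= ltnSn weight_ge0.
have an' : (a.+1 < n)%N by exact: leq_ltn_trans bn'.
rewrite /c (upper_weightE (Ordinal an) (Ordinal bn)) (upper_weightE (Ordinal an') (Ordinal bn)).
rewrite (upper_weightE (Ordinal an) (Ordinal bn')) (upper_weightE (Ordinal an') (Ordinal bn')) /=.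
have -> : (a < b.+1)%N by exact: leqW.
have -> : (a.+1 < b.+1)%N by [].
rewrite ab.
have -> : (if (a.+1 < b)%N then f (p (Ordinal an')) (p (Ordinal bn')) else 0) =
  f (p (Ordinal an')) (p (Ordinal bn')).
  case: ifP => // /negbT; rewrite -leqNgt => ba.
  have -> : Ordinal an' = Ordinal bn' by apply: val_inj => /=; apply/eqP; rewrite eqn_leq ba ab.
  by rewrite weightxx.
have := weight_mixed fW (x := p (Ordinal an)) (x' := p (Ordinal an'))
  (y := p (Ordinal bn')) (y' := p (Ordinal bn)).
rewrite !p_ge0 !hp//= => /(_ isT isT); lra.
Qed.

Lemma weight_diff0 (a b : nat) : (b < a)%N -> c a b = 0.
Proof.
by move=> ba; rewrite /c !upper_weight0 ?subrr// ltnW// ltnW.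
Qed.

(** Both sides expand with the same coefficients [c]: the right side is the sum for an antidiagonal
    matrix with entries [e], whose block sums are exactly the assumed bounds. The blocks can then be
    compared one at a time. *)
Lemma upper_weight_sum_le (g : 'I_n -> 'I_n -> R) (e : 'I_n -> R) :
  (forall a b, (a <= b < n)%N ->
    \sum_(i < n | (i < a)%N) \sum_(j < n | (b <= j)%N) g i j <=
    \sum_(k < n | (k < minn a (n - b))%N) e k) ->
  \sum_(i < n) \sum_(j < n) W i j * g i j <= \sum_(k < n) W k (rev_ord k) * e k.
Proof.
move=> H.
have lE : \sum_(i < n) \sum_(j < n) W i j * g i j = \sum_(a < n) \sum_(b < n) c a b *
    \sum_(i < n | (i < a.+1)%N) \sum_(j < n | (b.+1 <= j)%N) g i j.
  under eq_bigr do under eq_bigr do rewrite upper_weight_sum mulr_suml.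
  under eq_bigr do rewrite exchange_big /=.
  rewrite exchange_big /=; apply: eq_bigr => a _.
  under eq_bigr do under eq_bigr do rewrite mulr_suml.
  under eq_bigr do rewrite exchange_big /=.
  rewrite exchange_big /=; apply: eq_bigr => b _.
  rewrite mulr_sumr [RHS]big_mkcond; apply: eq_bigr => i _ /=.
  rewrite ltnS; case: leqP => ia; last by rewrite big1// => j _; rewrite mulr0 mul0r.
  rewrite mulr_sumr [RHS]big_mkcond; apply: eq_bigr => j _ /=.
  by case: ifP; rewrite ?mulr1 // mulr0 mul0r.
have rE : \sum_(k < n) W k (rev_ord k) * e k = \sum_(a < n) \sum_(b < n) c a b *
    \sum_(k < n | (k < minn a.+1 (n - b.+1))%N) e k.
  under eq_bigr do rewrite upper_weight_sum mulr_suml.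
  rewrite exchange_big /=; apply: eq_bigr => a _.
  under eq_bigr do rewrite mulr_suml.
  rewrite exchange_big /=; apply: eq_bigr => b _.
  rewrite mulr_sumr [RHS]big_mkcond; apply: eq_bigr => k _ /=.
  have -> : (k < minn a.+1 (n - b.+1))%N = (k <= a)%N && (b < n - k.+1)%N.
    by have := ltn_ord k; have := ltn_ord b; lia.
  by case: ifP; rewrite ?mulr1 // mulr0 mul0r.
rewrite lE rE; apply: ler_sum => a _; apply: ler_sum => b _.
have [ba|ab] := ltnP b a; first by rewrite weight_diff0// !mul0r.
have [bn|nb] := ltnP b.+1 n.
  by apply: ler_wpM2l; [exact: weight_diff_ge0|apply: H; rewrite ltnS ab].
(* For b the last index the sign of [c a b] is not controlled, but the block {j > b} is empty and
   both sums vanish. *)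
rewrite big1 => [|i _]; last first.
  by rewrite big_pred0// => j; apply/negbTE; rewrite -ltnNge; exact: leq_trans (ltn_ord j) nb.
rewrite big_pred0// => k; move: nb; rewrite -subn_eq0 => /eqP ->.
by rewrite minn0.
Qed.

Lemma sum_weight_sym (g : 'I_n -> 'I_n -> R) : (forall i j, g i j = g j i) ->
  \sum_i \sum_j f (p i) (p j) * g i j = 2 * \sum_(i < n) \sum_(j < n) W i j * g i j.
Proof.
move=> gC.
have -> : \sum_i \sum_j f (p i) (p j) * g i j = \sum_(i < n) \sum_(j < n) (W i j + W j i) * g i j.
  apply: eq_bigr => i _; apply: eq_bigr => j _; congr (_ * _); rewrite !upper_weightE.
  have [ij|ij|/val_inj ->] := ltngtP i j; rewrite ?addr0 ?add0r ?weightxx//.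
  exact: weightC.
have -> : \sum_(i < n) \sum_(j < n) (W i j + W j i) * g i j =
    \sum_(i < n) \sum_(j < n) W i j * g i j + \sum_(i < n) \sum_(j < n) W j i * g i j.
  rewrite -big_split; apply: eq_bigr => i _; rewrite -big_split; apply: eq_bigr => j _.
  by rewrite /= mulrDl.
rewrite [X in _ + X]exchange_big /=.
under [X in _ + X]eq_bigr do under eq_bigr do rewrite gC.
by rewrite mulr_natl mulr2n.
Qed.

End Weights.

(** * Complex matrices and their spectral decomposition *)

(* [dg] and [conjugate] are locked because unification otherwise unfolds matrix
   products, which is prohibitively slow. *)
HB.lock Definition dg (R : realType) (d : nat) (u : 'I_d -> R[i]) : 'M[R[i]]_d :=
  diag_mx (\row_j u j).

HB.lock Definition conjugate (R : realType) (d : nat) (U A : 'M[R[i]]_d) :=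
  U *m A *m dagger U.

Section Matrices.
Variables (R : realType) (d : nat).
Local Notation C := R[i].
Local Notation mat := 'M[C]_d.
Local Notation Re := complex.Re.
Local Notation Im := complex.Im.
Implicit Types (A B U V : mat) (u v : 'I_d -> C).

Lemma daggerE A i j : dagger A i j = Num.conj (A j i).
Proof. by rewrite !mxE. Qed.

Lemma daggerK A : dagger (dagger A) = A.
Proof. by apply/matrixP => i j; rewrite !daggerE conjCK. Qed.

Lemma daggerM A B : dagger (A *m B) = dagger B *m dagger A.
Proof. by rewrite /dagger map_mxM trmx_mul. Qed.

Lemma daggerD A B : dagger (A + B) = dagger A + dagger B.
Proof. by rewrite /dagger map_mxD linearD. Qed.

Lemma daggerN A : dagger (- A) = - dagger A.
Proof. by rewrite /dagger map_mxN linearN. Qed.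

Lemma dagger1 : dagger 1%:M = 1%:M :> mat.
Proof. by rewrite /dagger map_mx1 trmx1. Qed.

Lemma tr_dagger A : \tr (dagger A) = Num.conj (\tr A).
Proof. by rewrite /dagger mxtrace_tr -trace_map_mx. Qed.

Lemma cRe_conj (z : C) : Re (Num.conj z) = Re z. Proof. by case: z. Qed.
Lemma cIm_conj (z : C) : Im (Num.conj z) = - Im z. Proof. by case: z. Qed.
Lemma cRe_add (x y : C) : Re (x + y) = Re x + Re y. Proof. by case: x y => ? ? []. Qed.
Lemma cIm_add (x y : C) : Im (x + y) = Im x + Im y. Proof. by case: x y => ? ? []. Qed.
Lemma cRe_opp (x : C) : Re (- x) = - Re x. Proof. by case: x. Qed.
Lemma cIm_opp (x : C) : Im (- x) = - Im x. Proof. by case: x. Qed.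
Lemma cRe_mul (x y : C) : Re (x * y) = Re x * Re y - Im x * Im y.
Proof. by case: x y => ? ? []. Qed.
Lemma cIm_mul (x y : C) : Im (x * y) = Re x * Im y + Im x * Re y.
Proof. by case: x y => ? ? []. Qed.
Lemma cRe_sum I (r : seq I) (P : pred I) (F : I -> C) :
  Re (\sum_(i <- r | P i) F i) = \sum_(i <- r | P i) Re (F i).
Proof. by elim/big_rec2: _ => // i x y _ <-; rewrite cRe_add. Qed.
Lemma cIm_sum I (r : seq I) (P : pred I) (F : I -> C) :
  Im (\sum_(i <- r | P i) F i) = \sum_(i <- r | P i) Im (F i).
Proof. by elim/big_rec2: _ => // i x y _ <-; rewrite cIm_add. Qed.
Lemma eq_ReIm (x y : C) : Re x = Re y -> Im x = Im y -> x = y.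
Proof. by case: x y => ? ? [? ?] /= -> ->. Qed.
Definition ReImE := (cRe_conj, cIm_conj, cRe_add, cIm_add, cRe_opp, cIm_opp, cRe_mul, cIm_mul).

Definition sqnorm (z : C) : R := Re z ^+ 2 + Im z ^+ 2.

Lemma sqnorm_ge0 z : 0 <= sqnorm z.
Proof. by rewrite addr_ge0 ?sqr_ge0. Qed.

Lemma sqnormE z : z * Num.conj z = (sqnorm z)%:C%C.
Proof. by apply: eq_ReIm; rewrite !ReImE /sqnorm /=; ring. Qed.

Lemma sqnorm_conj z : sqnorm (Num.conj z) = sqnorm z.
Proof. by rewrite /sqnorm !ReImE sqrrN. Qed.

Lemma sqnormM x y : sqnorm (x * y) = sqnorm x * sqnorm y.
Proof. by rewrite /sqnorm !ReImE; ring. Qed.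

Lemma sqnorm_real (x : R) : sqnorm x%:C%C = x ^+ 2.
Proof. by rewrite /sqnorm /= expr0n addr0. Qed.

Lemma sqnorm_eq0 z : sqnorm z = 0 -> z = 0.
Proof.
move/eqP; rewrite /sqnorm paddr_eq0 ?sqr_ge0// !sqrf_eq0 => /andP[/eqP a /eqP b].
exact: eq_ReIm.
Qed.

Definition rdg (x : 'I_d -> R) : mat := dg (fun j => (x j)%:C%C).

Lemma dgE u i j : dg u i j = u i *+ (i == j).
Proof. by rewrite dg.unlock !mxE. Qed.

Lemma dg_mulE u A i j : (dg u *m A) i j = u i * A i j.
Proof. by rewrite dg.unlock mul_diag_mx !mxE. Qed.

Lemma mul_dgE u A i j : (A *m dg u) i j = A i j * u j.
Proof. by rewrite dg.unlock mul_mx_diag !mxE. Qed.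

Lemma dgM u v : dg u *m dg v = dg (fun j => u j * v j).
Proof.
apply/matrixP => i j; rewrite dg_mulE !dgE.
by case: eqP => [->|]; rewrite ?mulr1n// !mulr0n mulr0.
Qed.

Lemma dgD u v : dg u + dg v = dg (fun j => u j + v j).
Proof. by apply/matrixP => i j; rewrite mxE !dgE mulrnDl. Qed.

Lemma eq_dg u v : u =1 v -> dg u = dg v.
Proof. by move=> uv; apply/matrixP => i j; rewrite !dgE uv. Qed.

Lemma dg1 : dg (fun=> 1) = 1%:M :> mat.
Proof. by apply/matrixP => i j; rewrite dgE mxE. Qed.

Lemma dagger_dg u : dagger (dg u) = dg (fun j => Num.conj (u j)).
Proof.
apply/matrixP => i j; rewrite daggerE !dgE eq_sym.
by case: eqP => [->|]; rewrite ?mulr1n// !mulr0n conjC0.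
Qed.

Lemma dagger_rdg x : dagger (rdg x) = rdg x.
Proof. by rewrite dagger_dg; apply: eq_dg => j; apply: eq_ReIm; rewrite !ReImE //= oppr0. Qed.

Lemma tr_dg u : \tr (dg u) = \sum_j u j.
Proof. by apply: eq_bigr => j _; rewrite dgE eqxx mulr1n. Qed.

Lemma unitary_dagger U : unitary_mx U -> U *m dagger U = 1%:M.
Proof. exact: mulmx1C. Qed.

Lemma unitary_mxV U : unitary_mx U -> unitary_mx (dagger U).
Proof. by move=> uU; rewrite /unitary_mx daggerK unitary_dagger. Qed.

Lemma unitary_mxM U V : unitary_mx U -> unitary_mx V -> unitary_mx (U *m V).
Proof.
by move=> uU uV; rewrite /unitary_mx daggerM mulmxA -(mulmxA _ _ U) uU mulmx1 uV.
Qed.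

Lemma unitary_mx1 : unitary_mx (1%:M : mat).
Proof. by rewrite /unitary_mx dagger1 mulmx1. Qed.

Lemma mulmxKd U A : unitary_mx U -> A *m U *m dagger U = A.
Proof. by move=> uU; rewrite -mulmxA unitary_dagger// mulmx1. Qed.

Lemma mulmxdK U A : unitary_mx U -> A *m dagger U *m U = A.
Proof. by move=> uU; rewrite -mulmxA uU mulmx1. Qed.

Lemma conjugate_def U A : conjugate U A = U *m A *m dagger U.
Proof. by rewrite conjugate.unlock. Qed.

Lemma conjugate_id U : unitary_mx U -> conjugate U 1%:M = 1%:M.
Proof. by move=> uU; rewrite conjugate_def mulmx1 (unitary_dagger uU). Qed.

Lemma conjugateM U A B : unitary_mx U ->
  conjugate U A *m conjugate U B = conjugate U (A *m B).
Proof. by move=> uU; rewrite conjugate.unlock !mulmxA mulmxdK. Qed.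

Lemma dagger_conjugate U A : dagger (conjugate U A) = conjugate U (dagger A).
Proof. by rewrite conjugate.unlock !daggerM daggerK mulmxA. Qed.

Lemma tr_conjugate U A : unitary_mx U -> \tr (conjugate U A) = \tr A.
Proof. by move=> uU; rewrite conjugate.unlock mxtrace_mulC mulmxA uU mul1mx. Qed.

Lemma conjugate_comp U V A : conjugate U (conjugate V A) = conjugate (U *m V) A.
Proof. by rewrite conjugate.unlock daggerM !mulmxA. Qed.

Lemma conjugate1 A : conjugate 1%:M A = A.
Proof. by rewrite conjugate.unlock dagger1 mulmx1 mul1mx. Qed.

Lemma conjugateK U A : unitary_mx U -> conjugate (dagger U) (conjugate U A) = A.
Proof. by move=> uU; rewrite conjugate_comp uU conjugate1. Qed.

Definition hs A : R := \sum_i \sum_j sqnorm (A i j).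

Lemma hs_ge0 A : 0 <= hs A.
Proof. by do 2!(apply: sumr_ge0 => ? _); apply: sqnorm_ge0. Qed.

Lemma hsE A : \tr (dagger A *m A) = (hs A)%:C%C.
Proof.
rewrite /hs exchange_big rmorph_sum; apply: eq_bigr => j _.
rewrite mxE rmorph_sum; apply: eq_bigr => i _.
by rewrite daggerE mulrC sqnormE.
Qed.

Lemma Re_hs A : Re (\tr (dagger A *m A)) = hs A.
Proof. by rewrite hsE. Qed.

Lemma hs_dagger A : hs (dagger A) = hs A.
Proof.
rewrite /hs exchange_big; apply: eq_bigr => i _; apply: eq_bigr => j _.
by rewrite daggerE sqnorm_conj.
Qed.

Lemma hs_mulUl U A : unitary_mx U -> hs (U *m A) = hs A.
Proof.
by move=> uU; rewrite -[LHS]Re_hs daggerM mulmxA -(mulmxA _ _ U) uU mulmx1 Re_hs.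
Qed.

Lemma hs_mulUr U A : unitary_mx U -> hs (A *m U) = hs A.
Proof.
move=> uU; rewrite -hs_dagger daggerM hs_mulUl ?hs_dagger//.
exact: unitary_mxV.
Qed.

Lemma hs_conjugate U A : unitary_mx U -> hs (conjugate U A) = hs A.
Proof. by move=> uU; rewrite conjugate.unlock hs_mulUr ?hs_mulUl//; apply: unitary_mxV. Qed.

Lemma unitarymxE U : U \is unitarymx -> unitary_mx U.
Proof.
move=> /unitarymxP UU; apply: mulmx1C; rewrite -[RHS]UU; congr (_ *m _).
by apply/matrixP => i j; rewrite daggerE !mxE.
Qed.

Lemma hermitian_spectral A : hermitian_mx A ->
  exists E x, unitary_mx E /\ A = conjugate E (rdg x).
Proof.
move=> hA.
have hA' : A \is hermsymmx.
  apply/is_hermitianmxP; rewrite expr0 scale1r -{1}hA.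
  by apply/matrixP => i j; rewrite daggerE !mxE.
have /orthomx_spectralP := hermitian_normalmx hA'.
set P := spectralmx A; set s := spectral_diag A.
have uP : unitary_mx P by apply/unitarymxE/spectral_unitarymx.
have -> : invmx P = dagger P.
  by apply: (can_inj (mulKmx (spectral_unit A))); rewrite mulmxV ?spectral_unit// unitary_dagger.
move=> AE; exists (dagger P), (fun j => Re (s 0 j)); split; first exact: unitary_mxV.
rewrite AE conjugate.unlock daggerK; congr (_ *m _ *m _).
apply/matrixP => i j; rewrite dgE !mxE.
have /mxOverP/(_ 0 i) := hermitian_spectral_diag_real hA'.
by move=> /RRe_real ->.
Qed.

Lemma sqnorm_hermitian (K : mat) i j : hermitian_mx K -> sqnorm (K i j) = sqnorm (K j i).
Proof. by move=> hK; rewrite -{1}hK daggerE sqnorm_conj. Qed.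

Lemma hermitian_conjugate_rdg U x : hermitian_mx (conjugate U (rdg x)).
Proof. by rewrite /hermitian_mx dagger_conjugate dagger_rdg. Qed.

End Matrices.

(** * Exponential of a skew-Hermitian matrix *)

Section Exponential.
Local Open Scope classical_set_scope.
Variables (R : realType).
Local Notation C := R[i].
Local Notation CF := (Num.NumField.sort (R[i] : numFieldType)).
Local Notation Re := complex.Re.
Local Notation Im := complex.Im.

Lemma cvg_complex (u : nat -> CF) (z : CF) :
  (fun n => Re (u n)) @ \oo --> Re z -> (fun n => Im (u n)) @ \oo --> Im z ->
  u @ \oo --> z.
Proof.
move=> cRe cIm; apply/cvgrPdist_lt => e; rewrite ltcE => /andP[/eqP e0 /= e_gt0].
have eE : e = (Re e)%:C%C by apply: eq_ReIm => //=.
rewrite eE.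
have e2 : 0 < Re e / 2 by rewrite divr_gt0.
move/cvgrPdist_lt : cRe => /(_ _ e2) cRe; move/cvgrPdist_lt : cIm => /(_ _ e2) cIm.
near=> n; rewrite normc_def ltcR.
have hR : `|Re z - Re (u n)| < Re e / 2 by near: n.
have hI : `|Im z - Im (u n)| < Re e / 2 by near: n.
rewrite !ReImE -(@ltr_pXn2r _ 2)// ?nnegrE ?sqrtr_ge0 ?ltW// sqr_sqrtr ?addr_ge0 ?sqr_ge0//.
move: hR hI; rewrite !ltr_norml => /andP[h1 h2] /andP[h3 h4].
nra.
Unshelve. all: by end_near. Qed.

Definition cis (x : R) : C := (cos x +i* sin x)%C.

Lemma cvg_cis (x : R) :
  series (fun k => (k`!%:R)^-1 * ((x%:C * 'i)%C) ^+ k : CF) @ \oo --> (cis x : CF).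
Proof.
have E k : (k`!%:R)^-1 * ((x%:C * 'i)%C) ^+ k = (cos_coeff x k +i* sin_coeff x k)%C.
  have -> : (k`!%:R : C)^-1 = ((k`!%:R)^-1)%:C%C by rewrite fmorphV rmorph_nat.
  have -> : ((x%:C * 'i)%C) ^+ k = (x ^+ k)%:C%C * ('i%C : C) ^+ k.
    by rewrite exprMn rmorphXn.
  have -> : ('i%C : C) ^+ k =
      (((~~ odd k)%:R * (-1) ^+ k./2) +i* ((odd k)%:R * (-1) ^+ k.-1./2))%C.
    rewrite -{1}(odd_double_half k) exprD -mul2n exprM sqr_i.
    have -> : (-1 : C) ^+ k./2 = ((-1) ^+ k./2)%:C%C by rewrite rmorphXn rmorphN1.
    case: (boolP (odd k)) => ok /=.
      have -> : k.-1./2 = k./2 by rewrite -{1}(odd_double_half k) ok add1n /= doubleK.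
      apply: eq_ReIm; rewrite !ReImE /= ?(mul0r, mulr0, mul1r, subr0, add0r)//.
    by apply: eq_ReIm; rewrite ?expr0 !ReImE /= ?(mul0r, mulr0, mul1r, subr0, addr0).
  by apply: eq_ReIm; rewrite !ReImE /= /cos_coeff /sin_coeff /=;
    rewrite ?(mul0r, mulr0, subr0, addr0) [LHS]mulrC; congr (_ / _); rewrite mulrC.
apply: cvg_complex.
- rewrite [X in X @ _ --> _](_ : _ = series (cos_coeff x)).
    rewrite /= unlock; exact: is_cvg_series_cos_coeff.
  by apply/funext => n; rewrite /series /= cRe_sum; apply: eq_bigr => k _; rewrite E.
- rewrite [X in X @ _ --> _](_ : _ = series (sin_coeff x)).
    rewrite /= unlock; exact: is_cvg_series_sin_coeff.
  by apply/funext => n; rewrite /series /= cIm_sum; apply: eq_bigr => k _; rewrite E.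
Qed.

Lemma cvg_mx m n (T : topologicalType) (u : nat -> 'M[T]_(m, n)) (M : 'M[T]_(m, n)) :
  (forall i j, (fun k => u k i j) @ \oo --> M i j) -> u @ \oo --> M.
Proof.
move=> uM A [P MP sPA].
have H : \forall k \near \oo, forall ij : 'I_m * 'I_n, P ij.1 ij.2 (u k ij.1 ij.2).
  by apply: filter_forall => -[i j]; exact: uM (MP i j).
by apply: filterS H => k H; apply: sPA => i j; exact: (H (i, j)).
Qed.

Lemma cvg_sumr (T : Type) (F : set_system T) (FF : Filter F) (K : numFieldType)
  (V : normedModType K) I (r : seq I) (f : I -> T -> V) (l : I -> V) :
  (forall i, f i @ F --> l i) -> (fun x => \sum_(i <- r) f i x) @ F --> \sum_(i <- r) l i.
Proof.
move=> fl; elim: r => [|a r ih].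
  rewrite big_nil (_ : (fun _ => _) = (fun=> 0)); first exact: cvg_cst.
  by apply/funext => x; rewrite big_nil.
rewrite big_cons (_ : (fun _ => _) = f a \+ (fun x => \sum_(i <- r) f i x)).
  exact: cvgD.
by apply/funext => x; rewrite /= big_cons.
Qed.

Variable d : nat.
Local Notation mat := 'M[C]_d.

Lemma conjugate_exp (G : mat) (u : 'I_d -> C) k : unitary_mx G ->
  conjugate G (dg u) ^+ k = conjugate G (dg (fun a => u a ^+ k)).
Proof.
move=> uG; elim: k => [|k ih].
  by rewrite expr0 (@eq_dg _ _ _ (fun=> 1))// dg1 conjugate.unlock mulmx1 unitary_dagger.
by rewrite exprS ih [LHS](conjugateM _ _ uG) dgM; congr conjugate; apply: eq_dg => a; rewrite exprS.
Qed.

Lemma scale_conjugate_dg c (G : mat) (u : 'I_d -> C) :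
  c *: conjugate G (dg u) = conjugate G (dg (fun a => c * u a)).
Proof.
rewrite conjugate.unlock scalemxAl scalemxAr; congr (_ *m _ *m _).
by apply/matrixP => i j; rewrite mxE !dgE mulrnAr.
Qed.

Lemma conjugateE (G : mat) (u : 'I_d -> C) i j :
  conjugate G (dg u) i j = \sum_a G i a * u a * Num.conj (G j a).
Proof. by rewrite conjugate.unlock mxE; apply: eq_bigr => a _; rewrite mul_dgE daggerE. Qed.

Lemma mexp_conjugate (G : mat) (h : 'I_d -> R) (x : R) : unitary_mx G ->
  mexp ((x%:C * 'i)%C *: conjugate G (rdg h)) = conjugate G (dg (fun a => cis (x * h a))).
Proof.
move=> uG; rewrite /mexp.
set u := series _.
pose V := ('M[CF]_d : normedModType CF).
suff H : (u : nat -> V) @ \oo --> (conjugate G (dg (fun a => cis (x * h a))) : V).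
  exact: (@cvg_lim V (@norm_hausdorff _ V) _ _ _ _ _ H).
rewrite /u {u}.
apply: (@cvg_mx _ _ CF) => i j.
rewrite [X in X @ _ --> _](_ : _ = (fun n => \sum_a G i a *
   (series (fun k => (k`!%:R)^-1 * (((x * h a)%:C * 'i)%C) ^+ k : CF) n : CF) * Num.conj (G j a) : CF)).
  rewrite conjugateE; apply: (@cvg_sumr _ _ _ CF) => a.
  apply: (@cvgMr_tmp CF); apply: (@cvgMl_tmp CF); exact: cvg_cis.
apply/funext => n; rewrite /series /= summxE.
under [RHS]eq_bigr do rewrite mulr_sumr mulr_suml.
rewrite exchange_big /=; apply: eq_bigr => k _.
rewrite mxE scale_conjugate_dg conjugate_exp// conjugateE mulr_sumr.
apply: eq_bigr => a _; rewrite rmorphM !exprMn; ring.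
Qed.

Lemma cis_conj x : Num.conj (cis x) = cis (- x).
Proof. by rewrite /cis cosN sinN.
Qed.
End Exponential.

(** * Trace norm and fidelity *)

Section Fidelity.
Variables (R : realType) (d : nat).
Local Notation C := R[i].
Local Notation mat := 'M[C]_d.
Local Notation Re := complex.Re.
Local Notation Im := complex.Im.
Implicit Types (A B U V : mat).

Lemma quad_col A (E : mat) a :
  ((map_mx Num.conj (col a E))^T *m A *m col a E) 0 0 = (dagger E *m A *m E) a a.
Proof.
rewrite !mxE; apply: eq_bigr => k _; rewrite !mxE; congr (_ * _).
by apply: eq_bigr => l _; rewrite !mxE.
Qed.

Lemma psd_conjugate_rdg_ge0 (E : mat) (p : 'I_d -> R) : unitary_mx E ->
  psd_mx (conjugate E (rdg p)) -> forall a, 0 <= p a.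
Proof.
move=> uE [_ pA] a; have := pA (col a E); rewrite quad_col.
have -> : dagger E *m conjugate E (rdg p) *m E = rdg p.
  by rewrite -[RHS](conjugateK (rdg p) uE) conjugate.unlock daggerK.
by rewrite dgE eqxx mulr1n ler0c.
Qed.

Lemma psd_spectral A : psd_mx A ->
  exists E p, [/\ unitary_mx E, (forall a, 0 <= p a) & A = conjugate E (rdg p)].
Proof.
move=> pA; have [hA _] := pA; have [E [p [uE AE]]] := hermitian_spectral hA.
exists E, p; split => //.
by apply: (psd_conjugate_rdg_ge0 uE); rewrite -AE.
Qed.

Lemma psd_gram A : psd_mx (dagger A *m A).
Proof.
split=> [|v]; first by rewrite /hermitian_mx daggerM daggerK.
have -> : (map_mx Num.conj v)^T *m (dagger A *m A) *m v =
  (map_mx Num.conj (A *m v))^T *m (A *m v).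
  by rewrite map_mxM trmx_mul !mulmxA.
rewrite mxE; apply: sumr_ge0 => i _.
by rewrite [X in X * _]mxE [X in X * _]mxE mulrC sqnormE ler0c sqnorm_ge0.
Qed.

Lemma psd_conjugate_rdg U (p : 'I_d -> R) : (forall a, 0 <= p a) -> psd_mx (conjugate U (rdg p)).
Proof.
move=> p0; have -> : conjugate U (rdg p) =
   dagger (rdg (fun a => Num.sqrt (p a)) *m dagger U) *m (rdg (fun a => Num.sqrt (p a)) *m dagger U).
  rewrite conjugate.unlock daggerM daggerK dagger_rdg !mulmxA; congr (_ *m _); rewrite -mulmxA dgM.
  by congr (_ *m _); apply: eq_dg => a; rewrite -rmorphM -expr2 sqr_sqrtr.
exact: psd_gram.
Qed.

Lemma psd_conjugate U A : unitary_mx U -> psd_mx A -> psd_mx (conjugate U A).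
Proof.
move=> uU /psd_spectral[E [p [uE p0 ->]]]; rewrite conjugate_comp.
exact: psd_conjugate_rdg.
Qed.

(** Uniqueness of the root: if F diag(b) F^* is another one, the overlap matrix F^* U intertwines
    diag(b^2) with diag(p). Each nonzero entry forces b_i^2 = p_j, hence b_i = sqrt p_j, so it
    intertwines the roots as well. *)
Lemma msqrt_conjugate_rdg U (p : 'I_d -> R) : unitary_mx U -> (forall a, 0 <= p a) ->
  msqrt (conjugate U (rdg p)) = conjugate U (rdg (fun a => Num.sqrt (p a))).
Proof.
move=> uU p0; rewrite /msqrt; apply: xget_unique => [|B].
  split; first by apply: psd_conjugate_rdg => a; apply: sqrtr_ge0.
  rewrite conjugateM// dgM; congr conjugate; apply: eq_dg => a.
  by rewrite -rmorphM -expr2 sqr_sqrtr.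
move=> [/psd_spectral[F [b [uF b0 ->]]]]; rewrite conjugateM// dgM => BB.
have E : dg (fun j => (b j)%:C%C * (b j)%:C%C) *m (dagger F *m U) = dagger F *m U *m rdg p.
  have := congr1 (fun X => dagger F *m X *m U) BB.
  rewrite conjugate.unlock !mulmxA uF mul1mx => ->.
  by rewrite -!mulmxA uU mulmx1.
have {}E : rdg b *m (dagger F *m U) = dagger F *m U *m rdg (fun a => Num.sqrt (p a)).
  apply/matrixP => i j; move/matrixP/(_ i j): E.
  rewrite !dg_mulE !mul_dgE; set m := (dagger F *m U) i j.
  have [->|m0] := eqVneq m 0; first by rewrite !mulr0 !mul0r.
  rewrite [RHS]mulrC => /(mulIf m0); rewrite -rmorphM => -[] <-.
  by rewrite -expr2 sqrtr_sqr ger0_norm// mulrC.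
have := congr1 (fun X => F *m X *m dagger U) E.
rewrite !mulmxA mulmxKd// unitary_dagger// mul1mx => EE.
by rewrite conjugate.unlock EE.
Qed.

Lemma msqrt_conjugate U A : unitary_mx U -> psd_mx A ->
  msqrt (conjugate U A) = conjugate U (msqrt A).
Proof.
move=> uU /psd_spectral[E [p [uE p0 ->]]].
by rewrite conjugate_comp !msqrt_conjugate_rdg ?conjugate_comp//; apply: unitary_mxM.
Qed.

Lemma trnorm_conjugate U A : unitary_mx U -> trnorm (conjugate U A) = trnorm A.
Proof.
move=> uU; rewrite /trnorm dagger_conjugate conjugateM// msqrt_conjugate//.
  by rewrite tr_conjugate.
exact: psd_gram.
Qed.

Lemma fidelity_conjugate U A B : unitary_mx U -> psd_mx A -> psd_mx B ->
  fidelity (conjugate U A) (conjugate U B) = fidelity A B.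
Proof.
move=> uU pA pB; rewrite /fidelity (msqrt_conjugate uU pA) (msqrt_conjugate uU pB).
by rewrite (conjugateM _ _ uU) (trnorm_conjugate _ uU).
Qed.

Lemma Re_tr_rdg (x : 'I_d -> R) : Re (\tr (rdg x)) = \sum_a x a.
Proof. by rewrite tr_dg cRe_sum. Qed.

(** Only right singular vectors are produced: the columns of A E are orthogonal with lengths [t].
    Normalizing them would need a choice where [t] vanishes. *)
Lemma singular_values A : exists E t, [/\ unitary_mx E, (forall a, 0 <= t a),
  dagger (A *m E) *m (A *m E) = rdg (fun a => t a ^+ 2) & trnorm A = \sum_a t a].
Proof.
have [E [p [uE p0 AA]]] := psd_spectral (psd_gram A).
exists E, (fun a => Num.sqrt (p a)); split => //.
- rewrite daggerM mulmxA -(mulmxA (dagger E)) AA conjugate.unlock !mulmxA uE mul1mx mulmxdK//.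
  by apply: eq_dg => a; rewrite sqr_sqrtr.
- by rewrite /trnorm AA msqrt_conjugate_rdg// tr_conjugate// Re_tr_rdg.
Qed.

Lemma gram_diag A i : (dagger A *m A) i i = (\sum_l sqnorm (A l i))%:C%C.
Proof. by rewrite mxE rmorph_sum; apply: eq_bigr => l _; rewrite daggerE mulrC sqnormE. Qed.

Lemma Re_conjM_le (t : R) (x y : C) : 0 <= t -> (t = 0 -> y = 0) ->
  Re (Num.conj x * y) <= (t * sqnorm x + t^-1 * sqnorm y) / 2.
Proof.
rewrite le0r => /predU1P[->/(_ erefl)->|t0 _].
  by rewrite mulr0 /sqnorm /= expr0n /= !(mul0r, mulr0, addr0).
rewrite -subr_ge0 !ReImE /sqnorm.
have -> : (t * (Re x ^+ 2 + Im x ^+ 2) + t^-1 * (Re y ^+ 2 + Im y ^+ 2)) / 2 -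
   (Re x * Re y - - Im x * Im y) =
  t^-1 / 2 * ((t * Re x - Re y) ^+ 2 + (t * Im x - Im y) ^+ 2).
  by field; rewrite gt_eqF.
by rewrite mulr_ge0 ?addr_ge0 ?sqr_ge0// divr_ge0// invr_ge0 ltW.
Qed.

(** The trace pairs column a of A E, of length [t a], with a unit column. [Re_conjM_le] with weight
    [t a] is Cauchy-Schwarz in a form that sums over the entries of a column to exactly [t a]. *)
Lemma trnorm_ge A W : unitary_mx W -> Re (\tr (A *m W)) <= trnorm A.
Proof.
move=> uW; have [E [t [uE t0 AA ->]]] := singular_values A.
have -> : \tr (A *m W) = \tr (dagger (dagger W *m E) *m (A *m E)).
  by rewrite daggerM daggerK [RHS]mxtrace_mulC !mulmxA mulmxKd.
rewrite cRe_sum; apply: ler_sum => a _; rewrite mxE cRe_sum.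
have At : \sum_l sqnorm ((A *m E) l a) = t a ^+ 2.
  by apply: complexI; rewrite -gram_diag AA dgE eqxx.
have WE : \sum_l sqnorm ((dagger W *m E) l a) = 1.
  apply: complexI; rewrite -gram_diag daggerM daggerK mulmxA -(mulmxA _ W) unitary_dagger//.
  by rewrite mulmx1 uE mxE eqxx.
apply: (@le_trans _ _ (\sum_l (t a * sqnorm ((dagger W *m E) l a) +
   (t a)^-1 * sqnorm ((A *m E) l a)) / 2)).
  apply: ler_sum => l _; rewrite daggerE; apply: Re_conjM_le => // ta0.
  apply: sqnorm_eq0; apply/eqP; move/eqP: At; rewrite ta0 expr0n /= psumr_eq0//.
    by move/allP/(_ l (mem_index_enum _)).
  by move=> *; apply: sqnorm_ge0.
rewrite -mulr_suml big_split /= -!mulr_sumr At WE.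
have [->|ta0] := eqVneq (t a) 0; first by rewrite !mul0r invr0 mul0r addr0 mul0r.
by rewrite expr2 mulKf// mulr1; lra.
Qed.

Lemma mxtraceN A : \tr (- A) = - \tr A.
Proof. exact: raddfN. Qed.

Lemma Re_tr_gram_le (X Y : mat) : Re (\tr (dagger X *m Y)) <= (hs X + hs Y) / 2.
Proof.
have := hs_ge0 (X - Y); rewrite -[X in 0 <= X -> _]Re_hs daggerD daggerN mulmxDl !mulmxDr.
rewrite !mulmxN !mulNmx opprK !mxtraceD !mxtraceN !cRe_add !cRe_opp !Re_hs.
have -> : Re (\tr (dagger Y *m X)) = Re (\tr (dagger X *m Y)).
  by rewrite -[LHS]cRe_conj -tr_dagger daggerM daggerK.
lra.
Qed.

Lemma hs_gramr A : hs A = Re (\tr (A *m dagger A)).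
Proof. by rewrite -(hs_dagger A) -Re_hs daggerK. Qed.

Lemma hs_mul_isometry (Z W : mat) : W *m (dagger W *m W) = W -> hs (Z *m W) <= hs Z.
Proof.
move=> WW; pose Q := 1%:M - W *m dagger W.
have hQ : dagger Q = Q by rewrite daggerD daggerN dagger1 daggerM daggerK.
have QQ : Q *m dagger Q = Q.
  rewrite hQ {1}/Q mulmxBl mul1mx /Q mulmxBr mulmx1 !mulmxA -(mulmxA W) WW.
  by rewrite subrr subr0.
have E1 : Z *m Q *m dagger (Z *m Q) = Z *m dagger Z - Z *m W *m dagger (Z *m W).
  rewrite !daggerM !mulmxA -(mulmxA Z) QQ.
  by rewrite /Q mulmxBr mulmx1 mulmxBl !mulmxA.
by rewrite -subr_ge0 (hs_gramr Z) (hs_gramr (Z *m W))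
  -cRe_opp -cRe_add -mxtraceN -mxtraceD -E1 -hs_gramr hs_ge0.
Qed.

(* W is the partial isometry of the polar decomposition of the product. *)
Lemma trnorm_le (Z1 Z2 : mat) : trnorm (dagger Z1 *m Z2) <= (hs Z1 + hs Z2) / 2.
Proof.
set A := dagger Z1 *m Z2; have [E [t [uE t0 AA ->]]] := singular_values A.
(* The inverse of 0 is 0, so [tV] is a pseudo-inverse and W^* W is the projection [P] onto the
   nonzero singular values. *)
pose tV a := (t a)^-1; pose P : mat := rdg (fun a => (t a != 0)%:R : R).
pose W := A *m E *m rdg tV.
have WW : dagger W *m W = P.
  rewrite daggerM dagger_rdg mulmxA -(mulmxA (rdg tV)) AA !dgM; apply: eq_dg => a.
  rewrite -!rmorphM /tV expr2; congr (_%:C)%C.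
  by have [->|ta0] := eqVneq (t a) 0; rewrite ?invr0 ?mul0r//= mulKf// divff.
have WP : W *m P = W.
  rewrite -mulmxA dgM; congr (_ *m _); apply: eq_dg => a; rewrite -rmorphM /tV.
  by have [->|ta0] := eqVneq (t a) 0; rewrite ?invr0 ?mul0r//= mulr1.
have hW : hs (Z1 *m W) <= hs Z1 by apply: hs_mul_isometry; rewrite WW.
have -> : \sum_a t a = Re (\tr (dagger (Z1 *m W) *m (Z2 *m E))).
  have -> : dagger (Z1 *m W) *m (Z2 *m E) = dagger W *m (A *m E) by rewrite daggerM !mulmxA.
  rewrite daggerM dagger_rdg -mulmxA AA dgM tr_dg cRe_sum; apply: eq_bigr => a _.
  rewrite -rmorphM /= /tV expr2.
  by have [->|ta0] := eqVneq (t a) 0; rewrite ?invr0 ?mul0r//= mulKf.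
apply: (le_trans (Re_tr_gram_le _ _)).
by rewrite ler_pM2r ?invr_gt0// (hs_mulUr Z2 uE) lerD2r.
Qed.

End Fidelity.

(** * Unitary evolution *)

Section Propagator.
Variables (R : realType) (d : nat).
Local Notation C := R[i].
Local Notation mat := 'M[C]_d.
Local Notation Re := complex.Re.
Local Notation Im := complex.Im.
Implicit Types (A B U V G : mat) (h : 'I_d -> R).

Lemma cisD (x y : R) : cis (x + y) = cis x * cis y.
Proof. by apply: eq_ReIm; rewrite !ReImE /= ?cosD// sinD addrC. Qed.

Lemma cis0 : cis (0 : R) = 1.
Proof. by apply: eq_ReIm; rewrite /= ?cos0 ?sin0. Qed.

(** This is exp(-i x H) for H = G diag(h) G^*. *)
Definition propagator G h (x : R) : mat := conjugate G (dg (fun a => cis (- x * h a))).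

Lemma dagger_propagator G h x : dagger (propagator G h x) = propagator G h (- x).
Proof.
rewrite /propagator dagger_conjugate dagger_dg; congr conjugate; apply: eq_dg => a.
by rewrite cis_conj !mulNr.
Qed.

Lemma propagatorD G h x y : unitary_mx G ->
  propagator G h (x + y) = propagator G h x *m propagator G h y.
Proof.
move=> uG; rewrite /propagator conjugateM// dgM; congr conjugate; apply: eq_dg => a.
by rewrite -cisD opprD mulrDl.
Qed.

Lemma propagator_unitary G h x : unitary_mx G -> unitary_mx (propagator G h x).
Proof.
move=> uG; rewrite /unitary_mx dagger_propagator -propagatorD// addNr /propagator.
rewrite (@eq_dg _ _ _ (fun=> 1)) => [|a]; last by rewrite oppr0 mul0r cis0.
by rewrite dg1 conjugate.unlock mulmx1 unitary_dagger.
Qed.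

Lemma evolveE G h (x : R) A : unitary_mx G ->
  evolve (conjugate G (rdg h)) x A = conjugate (propagator G h x) A.
Proof.
move=> uG; rewrite /evolve mexp_conjugate//.
have -> : - (x%:C * 'i)%C = ((- x)%:C * 'i)%C by rewrite rmorphN mulNr.
rewrite mexp_conjugate// conjugate.unlock dagger_propagator /propagator.
by congr (_ *m _ *m _); rewrite conjugate.unlock; congr (_ *m _ *m _);
  apply: eq_dg => a; rewrite ?mulNr ?opprK.
Qed.

Lemma evolveD H (x y : R) A : hermitian_mx H ->
  exists2 U, unitary_mx U &
    evolve H x A = conjugate U A /\ evolve H (x + y) A = conjugate U (evolve H y A).
Proof.
move=> /hermitian_spectral[G [h [uG ->]]].
exists (propagator G h x); first exact: propagator_unitary.
by rewrite !evolveE// conjugate_comp propagatorD.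
Qed.

Lemma fidelity_evolve H (x y : R) A : hermitian_mx H -> psd_mx A ->
  fidelity (evolve H x A) (evolve H (x + y) A) = fidelity A (evolve H y A).
Proof.
move=> hH pA; have [U uU [-> ->]] := evolveD x y A hH.
apply: (fidelity_conjugate uU pA).
have [G [h [uG ->]]] := hermitian_spectral hH; rewrite (evolveE _ _ _ uG).
exact: psd_conjugate (propagator_unitary h y uG) pA.
Qed.

Lemma superfidelity_conjugate U A B : unitary_mx U ->
  superfidelity (conjugate U A) (conjugate U B) = superfidelity A B.
Proof. by move=> uU; rewrite /superfidelity !conjugateM// !tr_conjugate. Qed.

Lemma superfidelity_evolve H (x y : R) A : hermitian_mx H ->
  superfidelity (evolve H x A) (evolve H (x + y) A) = superfidelity A (evolve H y A).
Proof.
move=> hH; have [U uU [-> ->]] := evolveD x y A hH.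
exact: superfidelity_conjugate.
Qed.

(** Preparing the state by U amounts to rotating the generator by U^*; afterwards the state can be
    kept diagonal. *)
Lemma evolve_conjugate U H (x : R) A : unitary_mx U -> hermitian_mx H ->
  evolve H x (conjugate U A) = conjugate U (evolve (conjugate (dagger U) H) x A).
Proof.
move=> uU /hermitian_spectral[G [h [uG ->]]].
have uUG : unitary_mx (dagger U *m G) by apply: unitary_mxM => //; apply: unitary_mxV.
rewrite conjugate_comp !evolveE// !conjugate_comp; congr conjugate.
rewrite /propagator -conjugate_comp; move: (conjugate G _) => X.
by rewrite conjugate.unlock daggerK !mulmxA unitary_dagger// mul1mx.
Qed.

Lemma hermitian_conjugate U A : hermitian_mx A -> hermitian_mx (conjugate U A).
Proof. by rewrite /hermitian_mx dagger_conjugate => ->. Qed.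

Lemma mul_dg_sandwichE (P N Q : mat) (u v : 'I_d -> C) i j :
  (P *m dg u *m N *m dg v *m Q) i j =
  \sum_a \sum_b P i a * u a * N a b * v b * Q b j.
Proof.
rewrite mxE exchange_big; apply: eq_bigr => b _; rewrite mul_dgE mxE !mulr_suml.
by apply: eq_bigr => a _; rewrite mul_dgE.
Qed.

Lemma tr_dg_gram (u v : 'I_d -> C) (M : mat) :
  \tr (dg u *m M *m dg v *m dagger M) = \sum_a \sum_b u a * v b * (sqnorm (M a b))%:C%C.
Proof.
apply: eq_bigr => a _; rewrite mxE; apply: eq_bigr => b _.
by rewrite mul_dgE dg_mulE daggerE -sqnormE; ring.
Qed.

End Propagator.

(** * Small-angle limits and bounds for sine and cosine *)

Section Trigonometric.
Local Open Scope classical_set_scope.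
Variable R : realType.

Lemma cvg_sin_div (x : R) : (fun y => sin (y * x) / y) @ 0^' --> x.
Proof.
have [] : is_derive (0 : R) 1 (sin \o (x \*: (@id R))) (cos (x *: 0) * (x *: 1)).
  by apply: is_derive1_comp.
rewrite /derive scaler0 cos0 mul1r /GRing.scale /= mulr1 => D DE.
rewrite -[X in _ --> X]DE.
move: D; rewrite /derivable /=; apply: cvg_trans; apply: near_eq_cvg; near=> y.
by rewrite /GRing.scale /= mulr1 addr0 mulr0 sin0 subr0 mulrC (mulrC x).
Unshelve. all: by end_near. Qed.

Lemma ler_sin (x : R) : 0 <= x -> `|sin x| <= x.
Proof.
move=> x0; have [|c _] := @MVT_segment R sin cos 0 x x0 (fun y _ => is_derive_sin y).
  by apply: continuous_subspaceT => y; exact: continuous_sin.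
by rewrite sin0 !subr0 => ->; rewrite normrM (ger0_norm x0) ler_piMl// cos_max.
Qed.

Lemma onem_cos (x : R) : 1 - cos x = 2 * sin (x / 2) ^+ 2.
Proof.
have -> : x = x / 2 *+ 2 by rewrite -mulr_natr divfK// pnatr_eq0.
rewrite cos_mulr2n -[X in _ = 2 * sin (X / 2) ^+ 2]mulr_natr mulfK ?pnatr_eq0// sin2cos2; ring.
Qed.

Lemma onem_cos_le (x : R) : 1 - cos x <= x ^+ 2 / 2.
Proof.
rewrite onem_cos.
have : `|sin (x / 2)| <= `|x / 2|.
  have [x0|x0] := leP 0 (x / 2); first by rewrite (ger0_norm x0) ler_sin.
  by rewrite -normrN -sinN (ltr0_norm x0) ler_sin// oppr_ge0 ltW.
rewrite -ler_sqr ?nnegrE// !real_normK ?num_real//; lra.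
Qed.

Lemma cvg_onem_cos_div2 (x : R) : (fun y => (1 - cos (y * x)) / y ^+ 2) @ 0^' --> x ^+ 2 / 2.
Proof.
have -> : x ^+ 2 / 2 = 2 * (x / 2 * (x / 2)) by field.
rewrite (_ : (fun _ => _) = fun y => 2 * (sin (y * (x / 2)) / y * (sin (y * (x / 2)) / y))).
  by apply: cvgMl_tmp; apply: cvgM; exact: cvg_sin_div.
by apply/funext => y; rewrite onem_cos -mulrA invfM; ring.
Qed.

Lemma cvg_cosB1_div (x : R) : (fun y => (cos (y * x) - 1) / y) @ 0^' --> 0.
Proof.
rewrite [X in _ --> X](_ : _ = - 0 * (x ^+ 2 / 2)); last by rewrite oppr0 mul0r.
have : (fun y => - y * ((1 - cos (y * x)) / y ^+ 2)) @ 0^' --> - 0 * (x ^+ 2 / 2).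
  by apply: cvgM; [apply: cvgN; exact: nbhs_dnbhs|exact: cvg_onem_cos_div2].
apply: cvg_trans; apply: near_eq_cvg; near=> y.
have y0 : y != 0 by near: y; exact: nbhs_dnbhs_neq.
by field.
Unshelve. all: by end_near. Qed.
End Trigonometric.

(** * Closed forms of the QFI and the sub-QFI *)

Section FidelityLowerBound.
Local Open Scope classical_set_scope.
Variables (R : realType) (d : nat).
Local Notation C := R[i].
Local Notation mat := 'M[C]_d.
Local Notation Re := complex.Re.
Local Notation Im := complex.Im.

Variables (p : 'I_d -> R) (K : mat).
Hypotheses (p_ge0 : forall i, 0 <= p i) (p_sum : \sum_i p i = 1) (hK : hermitian_mx K).
Let s i := Num.sqrt (p i).
Let S : mat := rdg s.

Lemma sqrt_rdg_gram : dagger S *m S = rdg p.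
Proof.
by rewrite dagger_rdg dgM; apply: eq_dg => i; rewrite -rmorphM -expr2 sqr_sqrtr.
Qed.

Lemma hs_sqrt_rdg : hs S = 1.
Proof. by rewrite -Re_hs sqrt_rdg_gram Re_tr_rdg. Qed.

Lemma msqrt_rdg : msqrt (rdg p) = S.
Proof.
have := msqrt_conjugate_rdg (@unitary_mx1 R d) p_ge0.
by rewrite !conjugate1.
Qed.

Lemma psd_rdg : psd_mx (rdg p).
Proof. by rewrite -sqrt_rdg_gram; exact: psd_gram. Qed.

Lemma fidelity_propagator G h x : unitary_mx G -> K = conjugate G (rdg h) ->
  fidelity (rdg p) (evolve K x (rdg p)) = trnorm (S *m conjugate (propagator G h x) S).
Proof.
move=> uG ->; rewrite (evolveE _ _ _ uG) /fidelity.
by rewrite (msqrt_conjugate (propagator_unitary h x uG) psd_rdg) msqrt_rdg.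
Qed.

(** Holds for every x, not only asymptotically: the real part of the trace with the unitary V W is
    an average of cosines with weights |M_ab|^2 of total 1, and 1 - cos y <= y^2 / 2 leaves the
    squared norm of K S - S K'. *)
Lemma fidelity_lower x :
  1 - fidelity (rdg p) (evolve K x (rdg p)) <=
  x ^+ 2 / 4 * \sum_i \sum_j bures_weight (p i) (p j) * sqnorm (K i j).
Proof.
have [G [h [uG KE]]] := hermitian_spectral hK.
(* Least-squares choice: among symmetric factors k_ij, the value 2 s_i s_j / (s_i^2 + s_j^2)
   minimizes (s_j - s_i k)^2 + (s_i - s_j k)^2. *)
pose K' : mat := \matrix_(i, j) (K i j * (2 * (s i * s j) / (p i + p j))%:C%C).
have hK' : hermitian_mx K'.
  apply/matrixP => i j; rewrite daggerE !mxE rmorphM; congr (_ * _).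
    exact: etrans (esym (daggerE K i j)) (congr1 (fun A : mat => A i j) hK).
  by apply: eq_ReIm; rewrite !ReImE /= ?oppr0// (mulrC (s j)) (addrC (p j)).
have [G' [k [uG' KE']]] := hermitian_spectral hK'.
rewrite (fidelity_propagator x uG KE).
set V := propagator G h x; pose W := propagator G' k (- x).
have uV : unitary_mx V by exact: propagator_unitary.
have uW : unitary_mx W by exact: propagator_unitary.
pose M := dagger G *m S *m G'.
have hM : hs M = 1.
  by rewrite (hs_mulUr _ uG') (hs_mulUl _ (unitary_mxV uG)) hs_sqrt_rdg.
have trE : Re (\tr (S *m conjugate V S *m (V *m W))) =
    \sum_a \sum_b sqnorm (M a b) * cos (x * (k b - h a)).
  have -> : S *m conjugate V S *m (V *m W) = S *m V *m S *m W.
    by rewrite conjugate.unlock !mulmxA mulmxdK.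
  have -> : \tr (S *m V *m S *m W) = \tr (dg (fun a => cis (- x * h a)) *m M *m
       dg (fun b => cis (- - x * k b)) *m dagger M).
    rewrite /V /W /propagator !conjugate.unlock /M !daggerM daggerK dagger_rdg !mulmxA.
    by rewrite [RHS]mxtrace_mulC !mulmxA [RHS]mxtrace_mulC !mulmxA.
  rewrite tr_dg_gram cRe_sum; apply: eq_bigr => a _; rewrite cRe_sum; apply: eq_bigr => b _.
  rewrite -cisD !ReImE /= mulr0 subr0 mulrC; congr (_ * cos _); ring.
have := trnorm_ge (S *m conjugate V S) (unitary_mxM uV uW); rewrite trE => le1.
have le2 : 1 - \sum_a \sum_b sqnorm (M a b) * cos (x * (k b - h a)) <=
    x ^+ 2 / 2 * \sum_a \sum_b sqnorm (M a b) * (h a - k b) ^+ 2.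
  rewrite -{1}hM /hs -sumrB mulr_sumr; apply: ler_sum => a _.
  rewrite -sumrB mulr_sumr; apply: ler_sum => b _.
  have := onem_cos_le (x * (k b - h a)); have := sqnorm_ge0 (M a b).
  set m := sqnorm _; set c := cos _ => m0 c1.
  rewrite -[X in X - _]mulr1 -mulrBr; apply: (le_trans (ler_wpM2l m0 c1)).
  by rewrite le_eqVlt; apply/orP; left; apply/eqP; ring.
have hsE1 : \sum_a \sum_b sqnorm (M a b) * (h a - k b) ^+ 2 = hs (K *m S - S *m K').
  have -> : K *m S - S *m K' = G *m (rdg h *m M - M *m rdg k) *m dagger G'.
    rewrite KE KE' /M !conjugate.unlock mulmxBr mulmxBl !mulmxA (unitary_dagger uG).
    by rewrite mul1mx !(mulmxKd _ uG').
  rewrite (hs_mulUr _ (unitary_mxV uG')) (hs_mulUl _ uG).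
  apply: eq_bigr => a _; apply: eq_bigr => b _.
  have -> : (rdg h *m M - M *m rdg k) a b = M a b * (h a - k b)%:C%C.
    by rewrite mxE [X in _ + X]mxE mul_dgE dg_mulE rmorphB mulrBr (mulrC (h a)%:C%C).
  by rewrite sqnormM sqnorm_real.
have hsE2 : hs (K *m S - S *m K') =
    \sum_i \sum_j sqnorm (K i j) * (p j * (p i - p j) ^+ 2 / (p i + p j) ^+ 2).
  apply: eq_bigr => i _; apply: eq_bigr => j _.
  rewrite [X in sqnorm X]mxE mul_dgE [X in _ + X]mxE dg_mulE [K' i j]mxE.
  have -> : K i j * (s j)%:C%C - (s i)%:C%C * (K i j * (2 * (s i * s j) / (p i + p j))%:C%C) =
     K i j * (s j - s i * (2 * (s i * s j) / (p i + p j)))%:C%C.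
    by rewrite rmorphB !rmorphM; ring.
  rewrite sqnormM sqnorm_real; congr (_ * _).
  have si : s i ^+ 2 = p i by rewrite sqr_sqrtr.
  have sj : s j ^+ 2 = p j by rewrite sqr_sqrtr.
  have [pij|pij] := eqVneq (p i + p j) 0.
    have pj0 : p j = 0.
      by move/eqP: pij; rewrite paddr_eq0// => /andP[_ /eqP].
    have sj0 : s j = 0 by rewrite /s pj0 sqrtr0.
    by rewrite pj0 sj0 !(mulr0, mul0r) subr0 expr0n.
  have -> : s j - s i * (2 * (s i * s j) / (p i + p j)) = s j * (p j - p i) / (p i + p j).
    by rewrite -si -sj; field; rewrite si sj.
  by rewrite exprMn exprMn exprVn sj -(sqrrN (p j - p i)) opprB.
have hsE3 : hs (K *m S - S *m K') = 1 / 2 * \sum_i \sum_j bures_weight (p i) (p j) * sqnorm (K i j).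
  set T := \sum_i \sum_j _.
  (* Adding the sum with i and j exchanged turns the factor p_j into p_i + p_j, which cancels one
     denominator. *)
  have : hs (K *m S - S *m K') + hs (K *m S - S *m K') = T.
    rewrite {1}hsE2 {1}exchange_big hsE2 -big_split; apply: eq_bigr => i _.
    rewrite -big_split; apply: eq_bigr => j _; rewrite /= (sqnorm_hermitian j i hK).
    rewrite -mulrDr mulrC; congr (_ * _).
    rewrite /bures_weight; have [pij|pij] := eqVneq (p i + p j) 0.
      by rewrite (addrC (p j) (p i)) pij expr0n /= invr0 !mulr0 addr0.
    by rewrite (addrC (p j) (p i)); field.
  lra.
apply: (le_trans _ (le_trans le2 _)); first by rewrite lerD2l lerN2.
rewrite hsE1 hsE3 mulrA le_eqVlt; apply/orP; left; apply/eqP; congr (_ * _).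
by field.
Qed.

End FidelityLowerBound.

(** * Upper bound on the fidelity by a positive test operator *)

Section AlbertiBound.
Local Open Scope classical_set_scope.
Variables (R : realType) (d : nat).
Local Notation C := R[i].
Local Notation mat := 'M[C]_d.
Local Notation Re := complex.Re.
Local Notation Im := complex.Im.

(** For A = E^* V S with S a Hermitian root of the state, this is the population of the evolved
    state on the m-th vector of the basis E. *)
Definition row_sqnorm (A : mat) m : R := \sum_j sqnorm (A m j).

Lemma row_gram (A : mat) m : (A *m dagger A) m m = (row_sqnorm A m)%:C%C.
Proof. by rewrite mxE rmorph_sum; apply: eq_bigr => j _; rewrite daggerE sqnormE. Qed.

Lemma row_sqnorm_mulU (A U : mat) m : unitary_mx U -> row_sqnorm (A *m U) m = row_sqnorm A m.
Proof.
move=> uU; apply: complexI.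
by rewrite -!row_gram daggerM !mulmxA (mulmxKd _ uU).
Qed.

Lemma hs_conjugate_rdg (E B : mat) (z : 'I_d -> R) : unitary_mx E ->
  hs (conjugate E (rdg z) *m B) = \sum_m z m ^+ 2 * row_sqnorm (dagger E *m B) m.
Proof.
move=> uE; rewrite conjugate.unlock -!mulmxA (hs_mulUl _ uE).
apply: eq_bigr => m _; rewrite /row_sqnorm mulr_sumr; apply: eq_bigr => j _.
by rewrite dg_mulE sqnormM sqnorm_real.
Qed.

(* Alberti's variational bound [F <= (tr (rho X) + tr (sigma X^-1)) / 2] for
   [X] diagonal in the basis [E]. *)
Lemma trnorm_mul_conjugate_le (E V S : mat) (y : 'I_d -> R) :
  unitary_mx E -> unitary_mx V -> dagger S = S -> (forall m, 0 < y m) ->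
  trnorm (S *m conjugate V S) <=
  (\sum_m (y m * row_sqnorm (dagger E *m S) m +
           (y m)^-1 * row_sqnorm (dagger E *m (V *m S)) m)) / 2.
Proof.
move=> uE uV hS y0.
pose Z1 : mat := conjugate E (rdg (fun m => Num.sqrt (y m))) *m S.
pose Z2 : mat := conjugate E (rdg (fun m => (Num.sqrt (y m))^-1)) *m conjugate V S.
have -> : S *m conjugate V S = dagger Z1 *m Z2.
  rewrite /Z1 /Z2 daggerM hS dagger_conjugate dagger_rdg mulmxA -(mulmxA S) conjugateM//.
  rewrite dgM (@eq_dg _ _ _ (fun=> 1)) => [|m].
    by rewrite dg1 (conjugate_id uE) mulmx1.
  by rewrite -rmorphM mulfV// gt_eqF// sqrtr_gt0.
apply: (le_trans (trnorm_le _ _)); rewrite ler_pM2r ?invr_gt0// /Z1 /Z2.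
rewrite !(hs_conjugate_rdg _ _ uE) -big_split /= le_eqVlt; apply/orP; left; apply/eqP.
apply: eq_bigr => m _; rewrite exprVn sqr_sqrtr ?ltW//; congr (_ + _ * _).
by rewrite (conjugate_def V) mulmxA (row_sqnorm_mulU _ _ (unitary_mxV uV)).
Qed.

Lemma row_sqnorm_propagator (E G S : mat) h (x : R) m : unitary_mx G ->
  row_sqnorm (dagger E *m (propagator G h x *m S)) m =
  \sum_a \sum_b
    let B := (dagger E *m G) m a * (dagger G *m (S *m dagger S) *m G) a b *
             (dagger G *m E) b m in
    Re B * cos (x * (h a - h b)) + Im B * sin (x * (h a - h b)).
Proof.
move=> uG; set X := dagger E *m (propagator G h x *m S).
have -> : row_sqnorm X m = Re ((X *m dagger X) m m) by rewrite row_gram.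
rewrite /X {X}.
have -> : dagger E *m (propagator G h x *m S) *m dagger (dagger E *m (propagator G h x *m S)) =
    dagger E *m G *m dg (fun a => cis (- x * h a)) *m (dagger G *m (S *m dagger S) *m G) *m
      dg (fun b => cis (- - x * h b)) *m (dagger G *m E).
  by rewrite !daggerM daggerK dagger_propagator /propagator !conjugate.unlock !mulmxA.
rewrite mul_dg_sandwichE cRe_sum; apply: eq_bigr => a _; rewrite cRe_sum; apply: eq_bigr => b _ /=.
set P := (dagger E *m G) m a; set N := (_ *m G) a b; set Q := (_ *m E) b m.
have -> : P * cis (- x * h a) * N * cis (- - x * h b) * Q =
   P * N * Q * cis (- (x * (h a - h b))).
  have -> : - (x * (h a - h b)) = - x * h a + - - x * h b by ring.
  by rewrite cisD; ring.
by rewrite cRe_mul /cis cosN sinN /= mulrN opprK.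
Qed.

(** The evolved state has derivative -i [K, rho] at 0. The commutator is skew-Hermitian, so its
    diagonal is imaginary and multiplication by -i returns the imaginary part. *)
Lemma cvg_row_sqnorm_propagator (E G S : mat) h m : unitary_mx G ->
  (fun x : R => (row_sqnorm (dagger E *m (propagator G h x *m S)) m -
                 row_sqnorm (dagger E *m S) m) / x) @ 0^' -->
  Im ((dagger E *m (conjugate G (rdg h) *m (S *m dagger S) -
                    (S *m dagger S) *m conjugate G (rdg h)) *m E) m m).
Proof.
move=> uG.
pose B a b := (dagger E *m G) m a * (dagger G *m (S *m dagger S) *m G) a b *
             (dagger G *m E) b m.
have -> : row_sqnorm (dagger E *m S) m = \sum_a \sum_b Re (B a b).
  have := @row_sqnorm_propagator E G S h 0 m uG.
  rewrite {1}/propagator (@eq_dg _ _ _ (fun=> 1)) => [|a]; last by rewrite oppr0 mul0r cis0.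
  rewrite dg1 (conjugate_id uG) mul1mx => ->.
  apply: eq_bigr => a _; apply: eq_bigr => b _ /=.
  by rewrite mul0r cos0 sin0 mulr1 mulr0 addr0.
rewrite [X in _ --> X](_ : _ = \sum_a \sum_b (Re (B a b) * 0 + Im (B a b) * (h a - h b))).
  rewrite (_ : (fun _ => _) = (fun x => \sum_a \sum_b
     (Re (B a b) * ((cos (x * (h a - h b)) - 1) / x) + Im (B a b) * (sin (x * (h a - h b)) / x)))).
    apply: (@cvg_sumr _ _ _ R) => a; apply: (@cvg_sumr _ _ _ R) => b.
    by apply: cvgD; apply: cvgMl_tmp; [exact: cvg_cosB1_div|exact: cvg_sin_div].
  apply/funext => x; rewrite row_sqnorm_propagator// -sumrB mulr_suml; apply: eq_bigr => a _.
  rewrite -sumrB mulr_suml; apply: eq_bigr => b _ /=; rewrite -/(B a b).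
  by ring.
have -> : dagger E *m (conjugate G (rdg h) *m (S *m dagger S) -
                    (S *m dagger S) *m conjugate G (rdg h)) *m E =
   dagger E *m G *m rdg h *m (dagger G *m (S *m dagger S) *m G) *m dg (fun=> 1) *m (dagger G *m E) -
   dagger E *m G *m dg (fun=> 1) *m (dagger G *m (S *m dagger S) *m G) *m rdg h *m (dagger G *m E).
  move: (S *m dagger S) (dagger E) (rdg h) => rho F D.
  rewrite dg1 !mulmx1 conjugate_def mulmxBr mulmxBl !mulmxA.
  by rewrite (mulmxKd (F *m G *m D *m dagger G *m rho) uG) (mulmxKd F uG).
rewrite mxE [X in _ + X]mxE !mul_dg_sandwichE -sumrB cIm_sum; apply: eq_bigr => a _.
rewrite -sumrB cIm_sum; apply: eq_bigr => b _.
set P := (dagger E *m G) m a; set N := (_ *m G) a b; set Q := (_ *m E) b m.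
have -> : P * (h a)%:C%C * N * 1 * Q - P * 1 * N * (h b)%:C%C * Q = B a b * (h a - h b)%:C%C.
  by rewrite (_ : B a b = P * N * Q)// rmorphB; ring.
by rewrite cIm_mul.
Qed.

End AlbertiBound.

(** * Second-order limits of the fidelity and the super-fidelity *)

Section ClosedForms.
Local Open Scope classical_set_scope.
Variables (R : realType) (d : nat).
Local Notation C := R[i].
Local Notation mat := 'M[C]_d.
Local Notation Re := complex.Re.
Local Notation Im := complex.Im.
Variables (p : 'I_d -> R) (K : mat).
Hypotheses (p_ge0 : forall i, 0 <= p i) (p_sum : \sum_i p i = 1) (hK : hermitian_mx K).
Let S : mat := rdg (fun i => Num.sqrt (p i)).
Let T := \sum_i \sum_j bures_weight (p i) (p j) * sqnorm (K i j).
(* the symmetric logarithmic derivative *)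
Let L : mat := \matrix_(i, j) (K i j * (0 +i* ((p i - p j) / (p i + p j)))%C).

Lemma sld_hermitian : hermitian_mx L.
Proof.
apply/matrixP => i j; rewrite daggerE !mxE rmorphM; congr (_ * _).
  exact: etrans (esym (daggerE K i j)) (congr1 (fun A : mat => A i j) hK).
by apply: eq_ReIm; rewrite !ReImE //= -mulNr opprB (addrC (p j) (p i)).
Qed.

Lemma sqrt_rdg_gramr : S *m dagger S = rdg p.
Proof. by rewrite -(sqrt_rdg_gram p_ge0) !dagger_rdg. Qed.

Lemma bures_weightE i j : bures_weight (p i) (p j) = ((p i - p j) / (p i + p j)) * (p i - p j).
Proof. by rewrite /bures_weight expr2 mulrAC. Qed.

(** [L] is normalized by rho' = L rho + rho L with rho' = -i [K, rho], half of the usual convention.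
    The left side is tr (L rho'), twice the tr (rho L^2) computed in [hs_sld]. *)
Lemma tr_sld_commutator : Im (\tr (L *m (K *m rdg p - rdg p *m K))) = T.
Proof.
rewrite cIm_sum; apply: eq_bigr => i _; rewrite mxE cIm_sum; apply: eq_bigr => j _.
have -> : (K *m rdg p - rdg p *m K) j i = Num.conj (K i j) * (p i - p j)%:C%C.
  rewrite mxE [X in _ + X]mxE mul_dgE dg_mulE.
  have -> : K j i = Num.conj (K i j).
    exact: etrans (esym (congr1 (fun A : mat => A j i) hK)) (daggerE K j i).
  by rewrite rmorphB mulrBr (mulrC (p j)%:C%C).
rewrite [L i j]mxE bures_weightE.
have -> (z c e : C) : z * c * (Num.conj z * e) = (sqnorm z)%:C%C * (c * e).
  by rewrite -sqnormE; ring.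
by rewrite !ReImE /= !(mul0r, mulr0, addr0, add0r) mulrC.
Qed.

Lemma hs_sld : hs (L *m S) = 1 / 2 * T.
Proof.
have E1 : hs (L *m S) =
    \sum_i \sum_j sqnorm (K i j) * (((p i - p j) / (p i + p j)) ^+ 2 * p j).
  apply: eq_bigr => i _; apply: eq_bigr => j _.
  rewrite mul_dgE [L i j]mxE !sqnormM sqnorm_real sqr_sqrtr//.
  by rewrite {2}/sqnorm /= expr0n add0r mulrA.
have : hs (L *m S) + hs (L *m S) = T.
  rewrite {1}E1 {1}exchange_big E1 -big_split; apply: eq_bigr => i _.
  rewrite -big_split; apply: eq_bigr => j _.
  rewrite /= (sqnorm_hermitian j i hK) -mulrDr mulrC; congr (_ * _).
  rewrite /bures_weight; have [pij|pij] := eqVneq (p i + p j) 0.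
    by rewrite (addrC (p j) (p i)) pij invr0 !mulr0 expr0n /= !mul0r addr0.
  by rewrite (addrC (p j) (p i)); field.
lra.
Qed.

Lemma cvg_onem_fidelity :
  (fun x : R => (1 - fidelity (rdg p) (evolve K x (rdg p))) / x ^+ 2) @ 0^' --> T / 4.
Proof.
have [G [h [uG KE]]] := hermitian_spectral hK.
have [E [l [uE LE]]] := hermitian_spectral sld_hermitian.
pose pm m := row_sqnorm (dagger E *m S) m.
pose q x m := row_sqnorm (dagger E *m (propagator G h x *m S)) m.
have pm1 : \sum_m pm m = 1.
  transitivity (hs (dagger E *m S)) => //.
  by rewrite (hs_mulUl _ (unitary_mxV uE)) (hs_sqrt_rdg p_ge0 p_sum).
have q1 x : \sum_m q x m = 1.
  transitivity (hs (dagger E *m (propagator G h x *m S))) => //.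
  by rewrite (hs_mulUl _ (unitary_mxV uE)) (hs_mulUl _ (propagator_unitary h x uG))
    (hs_sqrt_rdg p_ge0 p_sum).
pose dq m := Im ((dagger E *m (K *m rdg p - rdg p *m K) *m E) m m).
have cq m : (fun x => (q x m - pm m) / x) @ 0^' --> dq m.
  by have := @cvg_row_sqnorm_propagator R d E G S h m uG; rewrite sqrt_rdg_gramr -KE.
(* Exactly (1 - b) / x^2, where b is Alberti's bound for the test operator 1 + x L. Since both
   population vectors sum to 1, this is an identity without Taylor remainder, and only first
   derivatives of the populations enter its limit. *)
pose lo x := (\sum_m l m * (((q x m - pm m) / x - l m * pm m) / (1 + x * l m))) / 2.
apply: (@squeeze_cvgr _ _ _ _ lo (cst (T / 4))).
- near=> x.
  have x0 : x != 0 by near: x; exact: nbhs_dnbhs_neq.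
  have xl : forall m, 0 < 1 + x * l m.
    near: x; apply: filter_forall => m.
    have : (fun x => 1 + x * l m) @ 0^' --> 1 + 0 * l m.
      by apply: cvgD; [exact: cvg_cst|apply: cvgMr_tmp; exact: nbhs_dnbhs].
    by rewrite mul0r addr0 => /cvgr_gt; apply.
  have x2 : 0 < x ^+ 2 by rewrite exprn_even_gt0.
  apply/andP; split; last first.
    rewrite ler_pdivrMr//.
    apply: (le_trans (fidelity_lower p_ge0 p_sum hK x)).
    by rewrite /cst -/T le_eqVlt; apply/orP; left; apply/eqP; field.
  rewrite ler_pdivlMr// (fidelity_propagator p_ge0 x uG KE) -/S.
  have := trnorm_mul_conjugate_le uE (propagator_unitary h x uG) (@dagger_rdg R d _ : dagger S = S) xl.
  set t := trnorm _ => tle.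
  rewrite -lerN2 -(lerD2l 1) opprB addrCA subrr addr0; apply: (le_trans tle).
  have -> : 1 - lo x * x ^+ 2 = (\sum_m (pm m + q x m -
     (l m * (((q x m - pm m) / x - l m * pm m) / (1 + x * l m))) * x ^+ 2)) / 2.
    by rewrite sumrB big_split /= pm1 q1 -mulr_suml /lo; field.
  rewrite ler_pM2r ?invr_gt0//; apply: ler_sum => m _; rewrite -/(pm m) -/(q x m).
  rewrite le_eqVlt; apply/orP; left; apply/eqP; field.
  by rewrite x0 gt_eqF.
(* The limit is (tr (L rho') - tr (rho L^2)) / 2 = (T - T/2) / 2, matching the other side of the
   squeeze. *)
- have -> : T / 4 = (\sum_m l m * ((dq m - l m * pm m) / (1 + 0 * l m))) / 2.
    under eq_bigr do rewrite mul0r addr0 divr1 mulrBr mulrA -expr2.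
    rewrite sumrB.
    have -> : \sum_m l m ^+ 2 * pm m = 1 / 2 * T.
      by rewrite -hs_sld LE (hs_conjugate_rdg _ _ uE).
    have -> : \sum_m l m * dq m = T.
      rewrite -tr_sld_commutator LE.
      have -> : \tr (conjugate E (rdg l) *m (K *m rdg p - rdg p *m K)) =
                \tr (rdg l *m (dagger E *m (K *m rdg p - rdg p *m K) *m E)).
        move: (_ - _) (rdg l) => X D.
        by rewrite conjugate_def -!mulmxA [LHS]mxtrace_mulC !mulmxA.
      rewrite cIm_sum; apply: eq_bigr => m _; rewrite dg_mulE cIm_mul /= mul0r addr0.
      by [].
    by field.
  apply: cvgMr_tmp; apply: (@cvg_sumr _ _ _ R) => m; apply: cvgMl_tmp.
  apply: cvgM; first by apply: cvgB; [exact: cq|exact: cvg_cst].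
  apply: cvgV; first by rewrite mul0r addr0 oner_eq0.
  by apply: cvgD; [exact: cvg_cst|apply: cvgMr_tmp; exact: nbhs_dnbhs].
- exact: cvg_cst.
Unshelve. all: by end_near. Qed.

Lemma QFI_rdg theta : QFI K theta (rdg p) = 2 * T.
Proof.
rewrite /QFI (_ : (fun _ => _) =
    (fun x : R => (1 - fidelity (rdg p) (evolve K x (rdg p))) / x ^+ 2)); last first.
  by apply/funext => x; rewrite (fidelity_evolve theta x hK (psd_rdg p_ge0)).
by rewrite (cvg_lim _ cvg_onem_fidelity)//; field.
Qed.

Lemma purity_le1 : \sum_i p i ^+ 2 <= 1.
Proof.
rewrite -p_sum; apply: ler_sum => i _; rewrite expr2 ler_piMl//.
by rewrite -p_sum (bigD1 i)//= lerDl sumr_ge0.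
Qed.

Lemma hs_commutator :
  hs (K *m rdg p - rdg p *m K) = \sum_i \sum_j (p i - p j) ^+ 2 * sqnorm (K i j).
Proof.
apply: eq_bigr => i _; apply: eq_bigr => j _.
have -> : (K *m rdg p - rdg p *m K) i j = (p j - p i)%:C%C * K i j.
  by rewrite mxE [X in _ + X]mxE mul_dgE dg_mulE rmorphB mulrBl (mulrC (K i j)).
by rewrite sqnormM sqnorm_real -(sqrrN (p j - p i)) opprB.
Qed.

(** Evolution preserves purity, so the square root is that of a perfect square and equals 1 - tr
    rho^2. There remains tr rho^2 - tr (rho rho_x), written in the eigenbasis of the generator. *)
Lemma superfidelity_propagator G h x : unitary_mx G -> K = conjugate G (rdg h) ->
  let M := dagger G *m rdg p *m G in
  1 - superfidelity (rdg p) (evolve K x (rdg p)) =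
  \sum_a \sum_b sqnorm (M a b) * (1 - cos (x * (h b - h a))).
Proof.
move=> uG KE M.
have rr : Re (\tr (rdg p *m rdg p)) = \sum_i p i ^+ 2.
  by rewrite dgM tr_dg cRe_sum; apply: eq_bigr => i _; rewrite -rmorphM expr2.
have hM : hs M = \sum_i p i ^+ 2.
  rewrite (hs_mulUr _ uG) (hs_mulUl _ (unitary_mxV uG)) -Re_hs dagger_rdg; exact: rr.
rewrite /superfidelity KE (evolveE _ _ _ uG).
have uV := propagator_unitary h x uG.
rewrite (conjugateM _ _ uV) (tr_conjugate _ uV) rr -expr2 sqrtr_sqr ger0_norm ?subr_ge0 ?purity_le1//.
have -> : Re (\tr (rdg p *m conjugate (propagator G h x) (rdg p))) =
    \sum_a \sum_b sqnorm (M a b) * cos (x * (h b - h a)).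
  have -> : \tr (rdg p *m conjugate (propagator G h x) (rdg p)) =
      \tr (dg (fun a => cis (- x * h a)) *m M *m dg (fun b => cis (- - x * h b)) *m dagger M).
    rewrite (conjugate_def (propagator _ _ _)) dagger_propagator /propagator !conjugate_def.
    rewrite /M !daggerM daggerK dagger_rdg.
    rewrite !mulmxA [RHS]mxtrace_mulC !mulmxA [RHS]mxtrace_mulC !mulmxA.
    by [].
  rewrite tr_dg_gram cRe_sum; apply: eq_bigr => a _; rewrite cRe_sum; apply: eq_bigr => b _.
  rewrite -cisD !ReImE /= mulr0 subr0 mulrC; congr (_ * cos _); ring.
rewrite -hM opprD opprB addrCA [1 + _]addrC subrK addrC -sumrB; apply: eq_bigr => a _.
by rewrite -sumrB; apply: eq_bigr => b _; rewrite [RHS]mulrBr mulr1.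
Qed.

Lemma cvg_onem_sqrt_superfidelity :
  (fun x : R => (1 - Num.sqrt (superfidelity (rdg p) (evolve K x (rdg p)))) / x ^+ 2) @ 0^' -->
  hs (K *m rdg p - rdg p *m K) / 4.
Proof.
have [G [h [uG KE]]] := hermitian_spectral hK.
pose M := dagger G *m rdg p *m G.
pose F x := superfidelity (rdg p) (evolve K x (rdg p)).
have FE x : 1 - F x = \sum_a \sum_b sqnorm (M a b) * (1 - cos (x * (h b - h a))).
  exact: superfidelity_propagator.
have cF2 : (fun x => (1 - F x) / x ^+ 2) @ 0^' --> hs (K *m rdg p - rdg p *m K) / 2.
  have -> : hs (K *m rdg p - rdg p *m K) / 2 =
      \sum_a \sum_b sqnorm (M a b) * ((h b - h a) ^+ 2 / 2).
    have -> : K *m rdg p - rdg p *m K = G *m (rdg h *m M - M *m rdg h) *m dagger G.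
      rewrite KE conjugate_def /M mulmxBr mulmxBl !mulmxA (unitary_dagger uG) mul1mx.
      by rewrite (mulmxKd _ uG).
    rewrite (hs_mulUr _ (unitary_mxV uG)) (hs_mulUl _ uG) mulr_suml; apply: eq_bigr => a _.
    rewrite mulr_suml; apply: eq_bigr => b _.
    have -> : (rdg h *m M - M *m rdg h) a b = M a b * (h a - h b)%:C%C.
      by rewrite mxE [X in _ + X]mxE mul_dgE dg_mulE rmorphB mulrBr (mulrC (h a)%:C%C).
    by rewrite sqnormM sqnorm_real -(sqrrN (h a - h b)) opprB mulrA.
  rewrite (_ : (fun _ => _) = (fun x => \sum_a \sum_b sqnorm (M a b) *
      ((1 - cos (x * (h b - h a))) / x ^+ 2))).
    apply: (@cvg_sumr _ _ _ R) => a; apply: (@cvg_sumr _ _ _ R) => b.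
    by apply: cvgMl_tmp; exact: cvg_onem_cos_div2.
  apply/funext => x; rewrite FE mulr_suml; apply: eq_bigr => a _.
  by rewrite mulr_suml; apply: eq_bigr => b _; rewrite mulrA.
have cF : F @ 0^' --> (1 : R).
  have : (fun x => 1 - (1 - F x) / x ^+ 2 * (x * x)) @ 0^' -->
     1 - hs (K *m rdg p - rdg p *m K) / 2 * (0 * 0).
    apply: cvgB; first exact: cvg_cst.
    by apply: cvgM => //; apply: cvgM; exact: nbhs_dnbhs.
  rewrite !mulr0 subr0; apply: cvg_trans; apply: near_eq_cvg; near=> x.
  have x0 : x != 0 by near: x; exact: nbhs_dnbhs_neq.
  by rewrite -expr2 divfK ?expf_neq0// opprB addrC subrK.
have cS : (fun x => Num.sqrt (F x)) @ 0^' --> (1 : R).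
  by rewrite -[X in _ --> X]sqrtr1; apply: continuous_cvg => //; exact: sqrt_continuous.
(* Rationalization: 1 - sqrt F = (1 - F) / (1 + sqrt F) as soon as F is positive, which holds near
   0. *)
have : (fun x => (1 - F x) / x ^+ 2 * (1 + Num.sqrt (F x))^-1) @ 0^' -->
    hs (K *m rdg p - rdg p *m K) / 2 * (1 + 1)^-1.
  apply: cvgM => //; apply: cvgV; first by rewrite gt_eqF.
  by apply: cvgD => //; exact: cvg_cst.
have -> : hs (K *m rdg p - rdg p *m K) / 2 * (1 + 1)^-1 = hs (K *m rdg p - rdg p *m K) / 4 by field.
apply: cvg_trans; apply: near_eq_cvg; near=> x.
have x0 : x != 0 by near: x; exact: nbhs_dnbhs_neq.
have F0 : 0 < F x by near: x; move/cvgr_gt: cF; apply.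
rewrite -/(F x); have {1}-> : F x = Num.sqrt (F x) ^+ 2 by rewrite sqr_sqrtr// ltW.
have : 0 <= Num.sqrt (F x) by apply: sqrtr_ge0.
move: (Num.sqrt _) => r r0; have r1 : 1 + r != 0 by rewrite gt_eqF// ltr_pwDl.
by field; rewrite x0 r1.
Unshelve. all: by end_near. Qed.

Lemma subQFI_rdg theta :
  subQFI K theta (rdg p) = 2 * \sum_i \sum_j (p i - p j) ^+ 2 * sqnorm (K i j).
Proof.
rewrite /subQFI (_ : (fun _ => _) = (fun x : R =>
    (1 - Num.sqrt (superfidelity (rdg p) (evolve K x (rdg p)))) / x ^+ 2)); last first.
  by apply/funext => x; rewrite (superfidelity_evolve theta x _ hK).
by rewrite (cvg_lim _ cvg_onem_sqrt_superfidelity)// hs_commutator; field.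
Qed.

End ClosedForms.

(** * Off-diagonal blocks of a Hermitian matrix *)

Section Blocks.
Variables (R : realType) (d : nat).
Local Notation C := R[i].
Local Notation mat := 'M[C]_d.
Local Notation Re := complex.Re.
Local Notation Im := complex.Im.

Lemma unitary_col_perm (E : mat) (s : {perm 'I_d}) : unitary_mx E -> unitary_mx (col_perm s E).
Proof.
move=> uE; apply/matrixP => i j.
have := congr1 (fun A : mat => A (s i) (s j)) uE; rewrite !mxE (inj_eq perm_inj) => <-.
by apply: eq_bigr => k _; rewrite !daggerE !mxE.
Qed.

Lemma conjugate_col_perm (E : mat) (s : {perm 'I_d}) (x : 'I_d -> R) :
  conjugate (col_perm s E) (rdg (fun i => x (s i))) = conjugate E (rdg x).
Proof.
apply/matrixP => i j; rewrite !conjugateE [RHS](reindex_inj (@perm_inj _ s)) /=.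
by apply: eq_bigr => k _; rewrite !mxE.
Qed.

Lemma sorting_perm (x : 'I_d -> R) : exists s : {perm 'I_d}, nonincr (fun i => x (s i)).
Proof.
pose t := [tuple x i | i < d].
have : perm_eq (sort >=%R t) t by rewrite perm_sort.
move=> /tuple_permP[s sE]; exists s => i j ij.
have srt : sorted >=%R (sort >=%R t) by apply: sort_sorted => u v; exact: le_total.
have nE (k : 'I_d) : nth 0 (sort >=%R t) k = x (s k).
  by rewrite sE -tnth_nth !tnth_mktuple.
have tr : transitive (>=%R : rel R) by move=> a b c ab bc; exact: le_trans bc ab.
have sz (k : 'I_d) : (k < size (sort >=%R t))%N by rewrite size_sort size_tuple.
have K := sorted_leq_nth tr (@lexx _ R) 0 srt.
by have := K i j (sz i) (sz j) ij; rewrite !nE.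
Qed.

Lemma hermitian_spectral_sorted (A : mat) : hermitian_mx A ->
  exists E x, [/\ unitary_mx E, nonincr x & A = conjugate E (rdg x)].
Proof.
move=> /hermitian_spectral[E [x [uE ->]]]; have [s hs] := sorting_perm x.
exists (col_perm s E), (fun i => x (s i)); split => //.
- exact: unitary_col_perm.
- by rewrite conjugate_col_perm.
Qed.

Lemma mxrank_rdg_le (x : 'I_d -> R) : (\rank (rdg x : mat) <= #|[pred k | x k != 0%R]|)%N.
Proof.
have -> : rdg x = \sum_(k | x k != 0) (x k)%:C%C *: (delta_mx k k : mat).
  apply/matrixP => i j; rewrite dgE summxE big_mkcond (bigD1 i)//= big1 => [|k ki]; last first.
    by case: ifP => // _; rewrite !mxE eq_sym (negbTE ki) mulr0.
  rewrite addr0; have [->|x0] := eqVneq (x i) 0; first by rewrite mul0rn.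
  by rewrite !mxE eqxx eq_sym mulr_natr.
rewrite -sum1_card; elim/big_rec2: _ => [|k a B _ le]; first by rewrite mxrank0.
apply: (leq_trans (mxrank_add _ _)); apply: leq_add => //.
apply: (leq_trans (mxrankS (scalemx_sub _ (submx_refl _)))).
by rewrite mxrank_delta.
Qed.

(** The product with the pseudo-inverse plus the projection on the zeros of [x] is the identity;
    subadditivity of rank gives the bound. *)
Lemma mxrank_rdg_ge (x : 'I_d -> R) : (#|[pred k | x k != 0%R]| <= \rank (rdg x : mat))%N.
Proof.
pose y k : R := (x k == 0)%:R; pose A := [pred k | x k != 0].
have E1 : rdg x *m rdg (fun k => (x k)^-1) + rdg y = 1%:M.
  rewrite dgM dgD -dg1; apply: eq_dg => k; rewrite -rmorphM -rmorphD /y.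
  by have [->|xk] := eqVneq (x k) 0; rewrite ?mul0r ?add0r ?mulfV ?addr0 ?rmorph1.
have : (d <= \rank (rdg x : mat) + #|[pred k | y k != 0%R]|)%N.
  rewrite -{1}(mxrank1 C d) -E1; apply: (leq_trans (mxrank_add _ _)).
  by apply: leq_add; [exact: mxrankM_maxl|exact: mxrank_rdg_le].
have -> : #|[pred k | y k != 0%R]| = #|[predC A]|.
  apply: eq_card => k; rewrite !inE /= negbK /y.
  by case: (x k == 0); rewrite ?oner_eq0 ?eqxx.
by have := cardC A; rewrite card_ord => {1}<-; rewrite leq_add2r.
Qed.

Lemma mxrank_conjugate_rdg (E : mat) (x : 'I_d -> R) : unitary_mx E ->
  \rank (conjugate E (rdg x)) = #|[pred k | x k != 0%R]|.
Proof.
move=> uE; apply/eqP; rewrite eqn_leq; apply/andP; split.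
  rewrite conjugate_def; apply: (leq_trans (mxrankM_maxl _ _)).
  by apply: (leq_trans (mxrankM_maxr _ _)); exact: mxrank_rdg_le.
apply: (leq_trans (mxrank_rdg_ge x)).
rewrite -{1}(conjugateK (rdg x) uE) (conjugate_def (dagger E)).
by apply: (leq_trans (mxrankM_maxl _ _)); exact: mxrankM_maxr.
Qed.

Lemma Re_tr_conjugate2 (E F : mat) (h x : 'I_d -> R) : unitary_mx E -> unitary_mx F ->
  Re (\tr (conjugate E (rdg h) *m conjugate F (rdg x))) =
  \sum_a \sum_b h a * x b * sqnorm ((dagger E *m F) a b).
Proof.
move=> uE uF.
have -> : \tr (conjugate E (rdg h) *m conjugate F (rdg x)) =
    \tr (rdg h *m (dagger E *m F) *m rdg x *m dagger (dagger E *m F)).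
  move: (rdg h) (rdg x) => D D'.
  by rewrite daggerM daggerK !conjugate_def -!mulmxA [LHS]mxtrace_mulC !mulmxA.
rewrite tr_dg_gram cRe_sum; apply: eq_bigr => a _; rewrite cRe_sum; apply: eq_bigr => b _.
by rewrite -!rmorphM.
Qed.

Lemma unitary_row_sum (U : mat) a : unitary_mx U -> \sum_b sqnorm (U a b) = 1.
Proof.
move=> uU; apply: complexI; have := row_gram U a.
by rewrite (unitary_dagger uU) mxE eqxx.
Qed.

Lemma unitary_col_sum (U : mat) b : unitary_mx U -> \sum_a sqnorm (U a b) = 1.
Proof.
move=> uU; apply: complexI; have := gram_diag U b.
by rewrite uU mxE eqxx.
Qed.

(** The squared moduli of the entries of the unitary E^* F form a doubly stochastic matrix. *)
Lemma von_neumann_trace (E F : mat) (h x : 'I_d -> R) :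
  unitary_mx E -> unitary_mx F -> nonincr h -> nonincr x ->
  \sum_k h (rev_ord k) * x k <= Re (\tr (conjugate E (rdg h) *m conjugate F (rdg x))) <=
  \sum_k h k * x k.
Proof.
move=> uE uF hh hx; rewrite (Re_tr_conjugate2 _ _ uE uF).
have uEF := unitary_mxM (unitary_mxV uE) uF.
by rewrite rearrangement_rev ?rearrangement// => *;
  rewrite ?sqnorm_ge0 ?unitary_row_sum ?unitary_col_sum.
Qed.

Variables (H E : mat) (h : 'I_d -> R).
Hypotheses (uE : unitary_mx E) (hh : nonincr h) (HE : H = conjugate E (rdg h)).

(** Let X keep only the block of H and its adjoint, so that tr (H X) = tr X^2 = 2 B. Von Neumann's
    inequality for X and for -X, which have the same spectrum x, gives 4 B <= sum_k gap_k x_k. Now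
    gap x <= gap^2 / 4 + x^2 on the support of x and sum x^2 = 2 B, so 2 B is at most the sum of
    gap^2 / 4 over the support, which has at most 2 m indices; [sum_gap_le] concludes. *)
Lemma block_bound a b : (a <= b < d)%N ->
  \sum_(i < d | (i < a)%N) \sum_(j < d | (b <= j)%N) sqnorm (H i j) <=
  \sum_(k < d | (k < minn a (d - b))%N) gap h k ^+ 2 / 4.
Proof.
move=> /andP[ab bd]; set m := minn _ _; set B := \sum_(i < d | _) _.
have hH : hermitian_mx H by rewrite HE; exact: hermitian_conjugate_rdg.
have HC i j : H j i = Num.conj (H i j).
  exact: etrans (esym (congr1 (fun A : mat => A j i) hH)) (daggerE H j i).
pose inA (i : 'I_d) : R := (i < a)%N%:R; pose inB (i : 'I_d) : R := (b <= i)%N%:R.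
pose X : mat := rdg inA *m H *m rdg inB + rdg inB *m H *m rdg inA.
have XE i j : X i j = H i j * (inA i * inB j + inB i * inA j)%:C%C.
  by rewrite mxE !mul_dgE !dg_mulE rmorphD !rmorphM; ring.
have AB0 i : inA i * inB i = 0.
  by rewrite /inA /inB -natrM mulnb; case: ltnP => // ia; rewrite leqNgt (leq_trans ia ab).
have inA2 i : inA i * inA i = inA i by rewrite -natrM mulnb andbb.
have inB2 i : inB i * inB i = inB i by rewrite -natrM mulnb andbb.
have w2 i j : (inA i * inB j + inB i * inA j) ^+ 2 = inA i * inB j + inB i * inA j.
  have -> : (inA i * inB j + inB i * inA j) ^+ 2 = (inA i * inA i) * (inB j * inB j) +
    (inB i * inB i) * (inA j * inA j) + 2 * (inA i * inB i) * (inA j * inB j) by ring.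
  by rewrite AB0 mulr0 mul0r addr0 !inA2 !inB2.
have BE : B = \sum_i \sum_j inA i * inB j * sqnorm (H i j).
  rewrite /B big_mkcond; apply: eq_bigr => i _; rewrite /inA.
  case: ifP => _; last by rewrite big1// => j _; rewrite !mul0r.
  rewrite big_mkcond; apply: eq_bigr => j _; rewrite /inB mul1r.
  by case: ifP; rewrite ?mul1r ?mul0r.
have B2 : \sum_i \sum_j (inA i * inB j + inB i * inA j) * sqnorm (H i j) = 2 * B.
  transitivity (B + B); last by ring.
  have BE' : B = \sum_i \sum_j inB i * inA j * sqnorm (H i j).
    rewrite BE exchange_big; apply: eq_bigr => i _; apply: eq_bigr => j _.
    by rewrite (HC i j) sqnorm_conj (mulrC (inA j)).
  rewrite {1}BE BE' -big_split; apply: eq_bigr => i _.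
  by rewrite -big_split; apply: eq_bigr => j _; rewrite /= mulrDl.
have hsX : hs X = 2 * B.
  rewrite -B2; apply: eq_bigr => i _; apply: eq_bigr => j _.
  by rewrite XE sqnormM sqnorm_real w2 mulrC.
have trX : Re (\tr (H *m X)) = 2 * B.
  rewrite -B2 cRe_sum exchange_big; apply: eq_bigr => i _; rewrite mxE cRe_sum.
  apply: eq_bigr => j _; rewrite XE (HC i j) mulrA sqnormE sqnorm_conj -rmorphM.
  exact: mulrC.
have hX : hermitian_mx X.
  apply/matrixP => i j; rewrite daggerE !XE rmorphM; congr (_ * _); first exact: esym (HC j i).
  have -> : inA j * inB i + inB j * inA i = inA i * inB j + inB i * inA j by ring.
  by apply: eq_ReIm; rewrite !ReImE //= oppr0.
have [F [x [uF hx XF]]] := hermitian_spectral_sorted hX.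
(* The signature matrix negating the first a coordinates. X only links these to the others, so
   conjugation by [D] flips its sign. *)
pose D : mat := rdg (fun i => 1 - 2 * inA i).
have D2 : D *m D = 1%:M.
  rewrite dgM -dg1; apply: eq_dg => i; rewrite -rmorphM.
  have -> : (1 - 2 * inA i) * (1 - 2 * inA i) = 1 + 4 * (inA i * inA i - inA i) by ring.
  by rewrite inA2 subrr mulr0 addr0 rmorph1.
have uD : unitary_mx D by rewrite /unitary_mx dagger_rdg.
have DX : conjugate D X = - X.
  rewrite conjugate_def dagger_rdg; apply/matrixP => i j; rewrite mul_dgE dg_mulE [RHS]mxE !XE.
  set w := inA i * inB j + inB i * inA j.
  have sw : (1 - 2 * inA i) * w * (1 - 2 * inA j) = - w.
    have -> : (1 - 2 * inA i) * w * (1 - 2 * inA j) =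
      inA i * inB j - 2 * (inA i * inA i) * inB j - 2 * inA i * (inA j * inB j) +
      4 * (inA i * inA i) * (inA j * inB j) + inB i * inA j - 2 * (inA i * inB i) * inA j -
      2 * inB i * (inA j * inA j) + 4 * (inA i * inB i) * (inA j * inA j) by rewrite /w; ring.
    by rewrite !AB0 !inA2 /w; ring.
  rewrite -[RHS]mulrN -rmorphN -sw !rmorphM; ring.
have /andP[_ up] := von_neumann_trace uE uF hh hx.
have /andP[lo _] := von_neumann_trace uE (unitary_mxM uD uF) hh hx.
move: up lo; rewrite -conjugate_comp -XF DX -HE mulmxN mxtraceN cRe_opp trX => up lo.
have sumx : \sum_k x k ^+ 2 = 2 * B.
  rewrite -hsX XF (hs_conjugate _ uF) -Re_hs dagger_rdg dgM tr_dg cRe_sum.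
  by apply: eq_bigr => k _; rewrite -rmorphM expr2.
pose Z := [pred k | x k != 0].
have rk : (#|Z| <= m + m)%N.
  have rA : (\rank (rdg inA : mat) <= a)%N.
    apply: (leq_trans (mxrank_rdg_le _)).
    rewrite -sum1_card (eq_bigl (fun i : 'I_d => i < a)%N) => [|i]; last first.
      by rewrite unfold_in /= /inA pnatr_eq0 eqb0 negbK.
    by rewrite -(big_ord_widen d (fun=> 1%N) (leq_trans ab (ltnW bd))) sum1_card card_ord.
  have rB : (\rank (rdg inB : mat) <= d - b)%N.
    apply: (leq_trans (mxrank_rdg_le _)).
    rewrite -sum1_card (reindex_inj rev_ord_inj) /=.
    rewrite (eq_bigl (fun i : 'I_d => i < d - b)%N) => [|i]; last first.
      rewrite unfold_in /= /inB pnatr_eq0 eqb0 negbK /=.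
      by have := ltn_ord i; lia.
    by rewrite -(big_ord_widen d (fun=> 1%N) (leq_subr b d)) sum1_card card_ord.
  rewrite -(mxrank_conjugate_rdg x uF) -XF /X.
  apply: (leq_trans (mxrank_add _ _)); rewrite leq_add// leq_min.
    rewrite (leq_trans (mxrankM_maxr _ _) rB) andbT.
    by rewrite (leq_trans _ rA)// -mulmxA mxrankM_maxl.
  rewrite (leq_trans (mxrankM_maxr _ _) rA) /=.
  by rewrite (leq_trans _ rB)// -mulmxA mxrankM_maxl.
have md : (m + m <= d)%N by rewrite /m; lia.
have := sum_gap_le hh md rk.
have gx : \sum_k gap h k * x k <= \sum_(k | Z k) gap h k ^+ 2 / 4 + \sum_k x k ^+ 2.
  rewrite [X in _ <= X + _]big_mkcond -big_split; apply: ler_sum => k _ /=.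
  case: ifPn => [_|]; first by have := sqr_ge0 (gap h k / 2 - x k); nra.
  by rewrite negbK => /eqP ->; rewrite mulr0 expr0n addr0.
move: gx; rewrite -mulr_suml sumx.
have -> : \sum_k gap h k * x k = \sum_k h k * x k - \sum_k h (rev_ord k) * x k.
  by rewrite -sumrB; apply: eq_bigr => k _; rewrite mulrBl.
rewrite -mulr_suml; lra.
Qed.

End Blocks.

(** * The optimal state preparation *)

Section Optimum.
Local Open Scope classical_set_scope.
Variables (R : realType) (d : nat).
Local Notation C := R[i].
Local Notation mat := 'M[C]_d.
Local Notation Re := complex.Re.
Local Notation Im := complex.Im.

Lemma psd_evolve (K A : mat) x : hermitian_mx K -> psd_mx A -> psd_mx (evolve K x A).
Proof.
move=> /hermitian_spectral[G [h [uG ->]]] pA; rewrite (evolveE _ _ _ uG).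
exact: psd_conjugate (propagator_unitary h x uG) pA.
Qed.

Lemma QFI_conjugate (V H A : mat) theta : unitary_mx V -> hermitian_mx H -> psd_mx A ->
  QFI H theta (conjugate V A) = QFI (conjugate (dagger V) H) theta A.
Proof.
move=> uV hH pA; have hK := hermitian_conjugate (dagger V) hH.
apply: (congr1 (fun F : R -> R => 8 * lim (F @ 0^'))); apply/funext => x.
rewrite !(evolve_conjugate _ _ uV hH).
by rewrite (fidelity_conjugate uV (psd_evolve _ hK pA) (psd_evolve _ hK pA)).
Qed.

Lemma subQFI_conjugate (V H A : mat) theta : unitary_mx V -> hermitian_mx H ->
  subQFI H theta (conjugate V A) = subQFI (conjugate (dagger V) H) theta A.
Proof.
move=> uV hH.
apply: (congr1 (fun F : R -> R => 8 * lim (F @ 0^'))); apply/funext => x.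
by rewrite !(evolve_conjugate _ _ uV hH) (superfidelity_conjugate _ _ uV).
Qed.

Section Weighted.
Variables (f : R -> R -> R) (p h : 'I_d -> R).
Hypotheses (fW : block_weight f) (p_ge0 : forall i, 0 <= p i).
Hypotheses (hp : nonincr p) (hh : nonincr h).

Definition optimal_value : R :=
  2 * \sum_(k < d) upper_weight f p k (rev_ord k) * (gap h k ^+ 2 / 4).

Lemma weighted_sum_le (G : mat) : unitary_mx G ->
  \sum_i \sum_j f (p i) (p j) * sqnorm (conjugate G (rdg h) i j) <= optimal_value.
Proof.
move=> uG; have hK := hermitian_conjugate_rdg G h.
rewrite (sum_weight_sym p fW) => [|i j]; last exact: sqnorm_hermitian.
rewrite ler_pM2l//; apply: upper_weight_sum_le => // a b ab.
exact: (@block_bound R d _ G h uG hh erefl a b ab).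
Qed.

(** The diagonal of [K] is left free because the weight vanishes on equal arguments. *)
Lemma weighted_sum_eq (K : mat) : hermitian_mx K ->
  (forall i j, i != j -> sqnorm (K i j) = (j == rev_ord i)%:R * (gap h i ^+ 2 / 4)) ->
  \sum_i \sum_j f (p i) (p j) * sqnorm (K i j) = optimal_value.
Proof.
move=> hK KE; rewrite (sum_weight_sym p fW) => [|i j]; last exact: sqnorm_hermitian.
congr (_ * _); apply: eq_bigr => i _.
have E (j : 'I_d) : upper_weight f p i j * sqnorm (K i j) =
    upper_weight f p i j * ((j == rev_ord i)%:R * (gap h i ^+ 2 / 4)).
  have [<-|ij] := eqVneq i j; first by rewrite upper_weight0// !mul0r.
  by rewrite KE.
under eq_bigr do rewrite E.
rewrite (bigD1 (rev_ord i))//= eqxx mul1r big1 ?addr0// => j /negbTE ->.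
by rewrite mul0r mulr0.
Qed.

End Weighted.

(* In each pair [{k, rev k}] of eigenvectors of the generator the optimal state
   has the eigenvectors [(e_k +- e_(rev k)) / sqrt 2]. *)
Lemma pairing_unitary : ~~ odd d -> exists S : mat, unitary_mx S /\
  forall (h : 'I_d -> R) i j, i != j ->
    sqnorm ((dagger S *m rdg h *m S) i j) = (j == rev_ord i)%:R * (gap h i ^+ 2 / 4).
Proof.
move=> d_even; pose r : R := Num.sqrt 2^-1.
have rr : r * r = 2^-1 by rewrite -expr2 sqr_sqrtr.
(* The sign makes [S] a real symmetric Hadamard matrix on each pair; evenness of d ensures that no
   index is its own partner. *)
pose sg (i : 'I_d) : R := if (i < rev_ord i)%N then 1 else -1.
have sg2 i : sg i * sg i = 1 by rewrite /sg; case: ifP => _; ring.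
have revN (i : 'I_d) : (i == rev_ord i) = false.
  apply/eqP => /(congr1 val) /= E; move: d_even; have := ltn_ord i; lia.
have sgr i : sg (rev_ord i) = - sg i.
  rewrite /sg rev_ordK; have := revN i; rewrite -val_eqE /=.
  by case: (ltngtP (i : nat) (d - i.+1)%N) => //; rewrite ?opprK.
pose J : mat := \matrix_(i, j) (j == rev_ord i)%:R.
have JC i j : (i == rev_ord j) = (j == rev_ord i).
  by apply/eqP/eqP => ->; rewrite rev_ordK.
have dJ : dagger J = J.
  by apply/matrixP => i j; rewrite daggerE !mxE JC rmorph_nat.
have JM (A : mat) i j : (J *m A) i j = A (rev_ord i) j.
  rewrite mxE (bigD1 (rev_ord i))//= mxE eqxx mul1r big1 ?addr0// => k /negbTE ki.
  by rewrite mxE ki mul0r.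
pose S : mat := rdg (fun i => r * sg i) + rdg (fun=> r) *m J.
have dS : dagger S = S.
  rewrite daggerD daggerM !dagger_rdg dJ; congr (_ + _).
  by apply/matrixP => i j; rewrite mul_dgE dg_mulE mulrC.
have SM (A : mat) i j : (S *m A) i j = (r * sg i)%:C%C * A i j + r%:C%C * A (rev_ord i) j.
  by rewrite mulmxDl mxE dg_mulE -mulmxA dg_mulE JM.
have Sij i j : S i j = (r * (sg i *+ (i == j) + (j == rev_ord i)%:R))%:C%C.
  rewrite mxE dgE dg_mulE mxE mulrDr rmorphD; congr (_ + _).
    by rewrite mulrnAr rmorphMn.
  by rewrite rmorphM rmorph_nat.
have SE (h : 'I_d -> R) i j : (dagger S *m rdg h *m S) i j =
    ((h i + h (rev_ord i)) / 2 *+ (i == j) + sg i * gap h i / 2 *+ (j == rev_ord i))%:C%C.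
  rewrite dS -mulmxA SM !dg_mulE !Sij rev_ordK sgr (eq_sym (rev_ord i)) (eq_sym j i).
  rewrite -!rmorphM -rmorphD; congr (_%:C%C).
  rewrite /gap; set a : R := (i == j)%:R; set b : R := (j == rev_ord i)%:R.
  rewrite -[sg i *+ _]mulr_natr -[(- sg i) *+ _]mulr_natr -[_ / 2 *+ (i == j)]mulr_natr.
  rewrite -[_ / 2 *+ (j == _)]mulr_natr -/a -/b.
  transitivity (r * r * (sg i * sg i * h i * a + sg i * h i * b - sg i * h (rev_ord i) * b +
    h (rev_ord i) * a)); first by ring.
  by rewrite rr sg2; field.
exists S; split.
  have rdg1 : rdg (fun=> 1) = 1%:M :> mat by rewrite -dg1; apply: eq_dg => k; rewrite rmorph1.
  (* Unitarity is the entry formula [SE] at the constant spectrum 1, where all gaps vanish. *)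
  apply/matrixP => i j; have := SE (fun=> 1) i j; rewrite rdg1 mulmx1 => ->; rewrite mxE.
  rewrite /gap subrr mulr0 mul0r mul0rn addr0.
  by rewrite (_ : (1 + 1) / 2 = 1 :> R) ?rmorph_nat//; field.
move=> h i j /negbTE ij; rewrite SE ij mulr0n add0r sqnorm_real.
case: eqP => _; last by rewrite mulr0n expr0n mul0r.
rewrite mulr1n mul1r.
have -> : (sg i * gap h i / 2) ^+ 2 = sg i * sg i * (gap h i ^+ 2 / 4) by field.
by rewrite sg2 mul1r.
Qed.

Lemma simultaneous_optimum (rho H : mat) : (d = 1)%N \/ ~~ odd d ->
  density_mx rho -> hermitian_mx H ->
  exists Ustar : mat, unitary_mx Ustar /\
    forall U : mat, unitary_mx U -> forall theta : R,
      subQFI H theta (U *m rho *m dagger U) <= subQFI H theta (Ustar *m rho *m dagger Ustar) /\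
      QFI H theta (U *m rho *m dagger U) <= QFI H theta (Ustar *m rho *m dagger Ustar).
Proof.
move=> d_even [psd_rho tr_rho] hH.
have [S [uS SE]] : exists S : mat, unitary_mx S /\ forall (h : 'I_d -> R) i j, i != j ->
    sqnorm ((dagger S *m rdg h *m S) i j) = (j == rev_ord i)%:R * (gap h i ^+ 2 / 4).
  case: d_even => [d1|]; last exact: pairing_unitary.
  (* In dimension 1 there are no off-diagonal entries to prescribe. *)
  exists 1%:M; split=> [|h i j /eqP[]]; first exact: unitary_mx1.
  by apply: val_inj; have := ltn_ord i; have := ltn_ord j; move=> /=; lia.
have [hrho _] := psd_rho.
have [P [p [uP hp rhoE]]] := hermitian_spectral_sorted hrho.
have [E [h [uE hh HE]]] := hermitian_spectral_sorted hH.
have p_ge0 : forall i, 0 <= p i by apply: (psd_conjugate_rdg_ge0 uP); rewrite -rhoE.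
have p_sum : \sum_i p i = 1.
  by rewrite -Re_tr_rdg -(tr_conjugate _ uP) -rhoE tr_rho.
have rhoV V : V *m rho *m dagger V = conjugate (V *m P) (rdg p).
  by rewrite -conjugate_def rhoE conjugate_comp.
have hK V := hermitian_conjugate (dagger V) hH.
have QE V theta : unitary_mx V -> QFI H theta (conjugate V (rdg p)) =
    2 * \sum_i \sum_j bures_weight (p i) (p j) * sqnorm (conjugate (dagger V) H i j).
  move=> uV; rewrite (QFI_conjugate _ uV hH (psd_rdg p_ge0)).
  exact: (QFI_rdg p_ge0 p_sum (hK V)).
have sQE V theta : unitary_mx V -> subQFI H theta (conjugate V (rdg p)) =
    2 * \sum_i \sum_j (p i - p j) ^+ 2 * sqnorm (conjugate (dagger V) H i j).
  move=> uV; rewrite (subQFI_conjugate _ _ uV hH).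
  exact: (subQFI_rdg p_ge0 p_sum (hK V)).
have uES : unitary_mx (E *m S) by exact: unitary_mxM.
(* The k-th eigenvector of the state, in decreasing order of eigenvalues, is sent to the k-th paired
   vector E S e_k. Neither weight enters this choice. *)
exists (E *m S *m dagger P); split; first exact: unitary_mxM uES (unitary_mxV uP).
move=> U uU theta; have uUP := unitary_mxM uU uP.
have uG : unitary_mx (dagger (U *m P) *m E) by exact: unitary_mxM (unitary_mxV uUP) uE.
have KstarE : conjugate (dagger (E *m S)) H = dagger S *m rdg h *m S.
  rewrite HE conjugate_comp daggerM -mulmxA uE mulmx1.
  by rewrite conjugate_def daggerK.
have opt f : block_weight f -> \sum_i \sum_j f (p i) (p j) * sqnorm (conjugate (dagger (U *m P)) H i j)
    <= \sum_i \sum_j f (p i) (p j) * sqnorm (conjugate (dagger (E *m S)) H i j).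
  move=> fW; rewrite [leRHS](weighted_sum_eq (h := h) p fW (hK (E *m S))).
    by rewrite {1}HE conjugate_comp; exact: weighted_sum_le.
  by move=> i j ij; rewrite KstarE; exact: SE.
rewrite !rhoV (mulmxdK _ uP); split.
  by rewrite (sQE _ _ uUP) (sQE _ _ uES) ler_pM2l//; exact: (opt _ (sqr_block_weight R)).
by rewrite (QE _ _ uUP) (QE _ _ uES) ler_pM2l//; exact: (opt _ (bures_block_weight R)).
Qed.

End Optimum.

Theorem theorem2 (R : realType) (n : nat) (rho H : 'M[R[i]]_(2 ^ n)) :
  density_mx rho -> hermitian_mx H ->
  exists Ustar : 'M[R[i]]_(2 ^ n), unitary_mx Ustar /\
    forall U : 'M[R[i]]_(2 ^ n), unitary_mx U -> forall theta : R,
      subQFI H theta (U *m rho *m dagger U) <= subQFI H theta (Ustar *m rho *m dagger Ustar) /\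
      QFI H theta (U *m rho *m dagger U) <= QFI H theta (Ustar *m rho *m dagger Ustar).
Proof.
apply: simultaneous_optimum.
by case: n rho H => [|n] _ _; [left|right; rewrite oddX].
Qed.
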